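(* For each $\epsilon>0$ the scalar problem $$\big(-\xi A_0(u^\epsilon,v^\epsilon)+A_1(u^\epsilon,v^\epsilon)\big)u^\epsilon_\xi=\epsilon\,\big(B_0(u^\epsilon,v^\epsilon)u^\epsilon_\xi\big)_\xi,\qquad -\xi v^\epsilon_\xi=\epsilon^p v^\epsilon_{\xi\xi},$$ with $u^\epsilon(-M)=u_L$, $u^\epsilon(M)=u_R$, $v^\epsilon(-\infty)=-1$, $v^\epsilon(+\infty)=1$, admits a smooth solution $(u^\epsilon,v^\epsilon)\in C^0([-M,M],\Omega\times[-1,1])$ given by the implicit formula $$u^\epsilon(\xi)=u_L+(u_R-u_L)\,\frac{\int_{-M}^{\xi}e^{-h^\epsilon(u^\epsilon;\zeta)/\epsilon}\,B_0(u^\epsilon,v^\epsilon)^{-1}\,d\zeta}{\int_{-M}^{M}e^{-h^\epsilon(u^\epsilon;\zeta)/\epsilon}\,B_0(u^\epsilon,v^\epsilon)^{-1}\,d\zeta},\qquad v^\epsilon(\xi)=-1+2\,\frac{\int_{-\infty}^{\xi}e^{-\zeta^2/(2\epsilon^p)}\,d\zeta}{\int_{-\infty}^{+\infty}e^{-\zeta^2/(2\epsilon^p)}\,d\zeta},$$ where $$h^\epsilon(u^\epsilon;\xi)=\int_\alpha^\xi\big(\zeta-\lambda(u^\epsilon,v^\epsilon)\big)\,G(u^\epsilon,v^\epsilon)\,d\zeta$$ and $\alpha\in[-M,M]$ is arbitrary. Moreover, $u^\epsilon$ and $v^\epsilon$ are monotone, bounded and continuous, and have uniformly bounded total variation: $$TV(u^\epsilon)\le|u_R-u_L|,\qquad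 TV(v^\epsilon)\le 2.$$
   Context: Here $u_L,u_R\in\mathbb{R}$, $p>0$, $\Omega:=[\min(u_L,u_R),\max(u_L,u_R)]$, and $A_0,A_1,B_0$ are smooth scalar-valued functions of $(u,v)$ such that, for some constants $c_1,c_2,c_3$, $$0<c_1\le A_0(u,v),\qquad 0<c_2\le B_0(u,v)\le c_3.$$ They also satisfy the consistency conditions $A_0(u,\pm1)=\gamma_\pm'(u)$ and $A_1(u,\pm1)=(f_\pm\circ\gamma_\pm)'(u)$, where $f_-,f_+$ are smooth scalar flux functions and $\gamma_-,\gamma_+$ are given smooth invertible functions on $\mathbb{R}$. Set $\lambda(u,v):=A_1(u,v)/A_0(u,v)$ and $G(u,v):=A_0(u,v)/B_0(u,v)$. Let $\Lambda>0$ be such that $|\lambda(u,v)|\le\Lambda$ for $(u,v)\in\Omega\times[-1,1]$, and fix $M>\Lambda$. Inside the integrals, $u^\epsilon,v^\epsilon$ are evaluated at the integration variable $\zeta$. *)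

(* Defs.v *)
From Stdlib Require Import Reals FinFun.
From Coquelicot Require Import Coquelicot.
Open Scope R_scope.

Definition smooth (f : R -> R) : Prop :=
  forall (n : nat) (x : R), ex_derive_n f n x.

(* [f] is total on R, so at an end point [ex_derive_n] is a two-sided
   derivative: this says that f on [a, b] has a continuation past a and b
   with derivatives of all orders at every point of [a, b], which gives
   C^infinity up to the boundary.  The values of [f] away from [a, b] are
   irrelevant. *)
Definition smooth_on_segment (a b : R) (f : R -> R) : Prop :=
  forall (n : nat) (x : R), a <= x <= b -> ex_derive_n f n x.

(* [ex_diff_n g n x y]: all partial derivatives of order <= n exist and are
   continuous at (x, y). *)
Definition smooth2 (g : R -> R -> R) : Prop :=
  forall (n : nat) (x y : R), ex_diff_n g n x y.

(* Smoothness on the closed strip R x [-1, 1], as restriction of a smooth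
   function on the plane; values of [g] off the strip play no role. *)
Definition smooth_on_strip (g : R -> R -> R) : Prop :=
  exists g' : R -> R -> R,
    smooth2 g' /\ forall u v : R, -1 <= v <= 1 -> g' u v = g u v.

Definition Omega (uL uR x : R) : Prop := Rmin uL uR <= x <= Rmax uL uR.

Definition lambda (A0 A1 : R -> R -> R) (u v : R) : R := A1 u v / A0 u v.

Definition G (A0 B0 : R -> R -> R) (u v : R) : R := A0 u v / B0 u v.

Definition h (A0 A1 B0 : R -> R -> R) (u v : R -> R) (alpha xi : R) : R :=
  RInt (fun z => (z - lambda A0 A1 (u z) (v z)) * G A0 B0 (u z) (v z))
       alpha xi.

Definition u_density (A0 A1 B0 : R -> R -> R) (u v : R -> R)
    (alpha eps z : R) : R :=
  exp (- h A0 A1 B0 u v alpha z / eps) * / B0 (u z) (v z).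

Definition v_density (p eps z : R) : R :=
  exp (- z ^ 2 / (2 * Rpower eps p)).

Definition monotone_on (D : R -> Prop) (f : R -> R) : Prop :=
  (forall x y : R, D x -> D y -> x <= y -> f x <= f y) \/
  (forall x y : R, D x -> D y -> x <= y -> f y <= f x).

(* Supremum, in the extended reals, of the variation of [f] along all finite
   families x_0 <= x_1 <= ... <= x_(n+1) in [D]; [sum_f_R0 _ n] has n+1
   terms. *)
Definition total_variation (D : R -> Prop) (f : R -> R) : Rbar :=
  Lub_Rbar (fun s : R =>
    exists (n : nat) (x : nat -> R),
      (forall i : nat, (i <= S n)%nat -> D (x i)) /\
      (forall i : nat, (i <= n)%nat -> x i <= x (S i)) /\
      s = sum_f_R0 (fun i => Rabs (f (x (S i)) - f (x i))) n).

(* Main.v *)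
Require Import Defs.
From Stdlib Require Import Reals FinFun Lra Lia IndefiniteDescription.
From Coquelicot Require Import Coquelicot.
Open Scope R_scope.

(** The equation for v does not involve u: v' is a multiple of the Gaussian
    exp (- x^2 / (2 c)) with c = eps^p, so v is its odd primitive divided by
    the limit L of that primitive at infinity ([viscous_layer]).  Only the
    finiteness of L matters, not its value.

    Once v is known, write u = uL + (uR - uL) r.  With w = B0 u_x, the
    equation for u is the linear equation w_x = w Q_x, where
    Q_x = (- x A0 + A1) / (eps B0), so that r has to satisfy

      r(x) = th int_{-M}^x exp (Q(z)) / B0 dz,   Q(z) = int_{-M}^z Q_x,

    for some constant th, together with r(M) = 1.  This is the implicit formula
    of the theorem, since - h / eps is a primitive of Q_x; changing the base
    point alpha of h multiplies numerator and denominator by the same number.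
    As r' > 0, r maps [-M, M] into [0, 1]: the range, the monotonicity and the
    bound on the total variation of u follow.

    For a given th the integral equation is of Volterra type, hence solvable by
    contraction without any smallness assumption, provided that differences
    are measured against a weight cosh (k (x + M)) with k large: integration
    from -M divides that weight by k.  The coefficients have to be bounded and
    Lipschitz in r, which is arranged by replacing r by its truncation to
    [-1, 2] inside them.  The solution depends continuously on th, and r(M) is
    0 for th = 0 and at least 1 for large th, because exp (Q) / B0 is bounded
    below; the intermediate value theorem provides th with r(M) = 1
    ([shooting]).  For that th the values of r on [-M, M] lie in [0, 1], so the
    truncation is inactive there.

    The integral equation is solved on the larger interval [-M-1, M+1], because
    smoothness at -M and M is two-sided.  By continuity r stays in [-1, 2]
    slightly beyond -M and M, so on an open interval D containing [-M, M]
    the pair (r, Q) solves the untruncated differential system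
    ([viscous_profile]), and its right hand side gains one derivative at a
    time ([profile_class_C]). *)

(** * Variation of monotone functions *)

(** The sum of the increments of a monotone function telescopes, so that only
    the oscillation of [f] remains. *)
Lemma total_variation_monotone (D : R -> Prop) (f : R -> R) (l : R) :
  monotone_on D f ->
  (forall x y : R, D x -> D y -> Rabs (f x - f y) <= l) ->
  Rbar_le (total_variation D f) l.
Proof.
intros Hmon Hosc.
apply (proj2 (Lub_Rbar_correct _)).
intros s (n & x & HD & Hx & ->); simpl.
assert (Htel : forall m, (m <= n)%nat ->
  sum_f_R0 (fun i => Rabs (f (x (S i)) - f (x i))) m
  = Rabs (f (x (S m)) - f (x 0%nat)) /\ x 0%nat <= x (S m)).
{ induction m as [|m IH]; intros Hm; simpl.
  - split; [reflexivity | apply Hx; lia].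
  - destruct IH as [-> H0]; [lia|].
    pose proof (Hx (S m) Hm) as H1.
    split; [|lra].
    destruct Hmon as [Hi|Hd].
    + pose proof (Hi _ _ (HD 0%nat ltac:(lia)) (HD (S m) ltac:(lia)) H0).
      pose proof (Hi _ _ (HD (S m) ltac:(lia)) (HD (S (S m)) ltac:(lia)) H1).
      rewrite !Rabs_pos_eq by lra; lra.
    + pose proof (Hd _ _ (HD 0%nat ltac:(lia)) (HD (S m) ltac:(lia)) H0).
      pose proof (Hd _ _ (HD (S m) ltac:(lia)) (HD (S (S m)) ltac:(lia)) H1).
      rewrite !Rabs_left1 by lra; lra. }
(* [n + 1] increments, between the points of index 0 and n + 1 *)
destruct (Htel n (Nat.le_refl n)) as [-> _].
apply Hosc; apply HD; lia.
Qed.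

(** * Functions of class C^n on an open set *)

(** Derivatives are taken from the inside, as in [ex_diff_n], so that closure
    properties go by induction on [n] through one differentiation rule each. *)
Fixpoint class_C (n : nat) (D : R -> Prop) (f : R -> R) : Prop :=
  match n with
  | O => forall x, D x -> continuous f x
  | S m => (forall x, D x -> ex_derive f x) /\ class_C m D (Derive f)
  end.

Lemma class_C_ext (D : R -> Prop) (HD : open D) (n : nat) :
  forall f g : R -> R,
  (forall x, D x -> f x = g x) -> class_C n D f -> class_C n D g.
Proof.
induction n as [|n IH]; intros f g Hfg Hf; simpl in *.
- intros x Hx. apply continuous_ext_loc with f; [|now apply Hf].
  now apply filter_imp with D; [|apply HD].
- destruct Hf as [Hd Hf]; split.
  + intros x Hx. apply ex_derive_ext_loc with f; [|now apply Hd].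
    now apply filter_imp with D; [|apply HD].
  + apply (IH (Derive f)); [|exact Hf].
    intros x Hx. apply Derive_ext_loc.
    now apply filter_imp with D; [|apply HD].
Qed.

(** The way in which every closure property and every bootstrap below passes
    from order [n] to order [n + 1]. *)
Lemma class_C_is_derive (D : R -> Prop) (HD : open D) (n : nat)
    (f df : R -> R) :
  (forall x, D x -> is_derive f x (df x)) -> class_C n D df ->
  class_C (S n) D f.
Proof.
intros Hf Hdf; split.
- intros x Hx. exists (df x). now apply Hf.
- apply (class_C_ext D HD n df); [|exact Hdf].
  intros x Hx. symmetry. now apply is_derive_unique, Hf.
Qed.

Lemma class_C_pred (D : R -> Prop) (n : nat) :
  forall f, class_C (S n) D f -> class_C n D f.
Proof.
induction n as [|n IH]; intros f [Hd Hf].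
- intros x Hx. apply (ex_derive_continuous (K := R_AbsRing) (V := R_NormedModule) f x).
  now apply Hd.
- split; [exact Hd | now apply IH].
Qed.

Lemma class_C_const (D : R -> Prop) (HD : open D) (n : nat) :
  forall c : R, class_C n D (fun _ => c).
Proof.
induction n as [|n IH]; intros c.
- intros x _. apply continuous_const.
- apply (class_C_is_derive D HD n _ (fun _ => 0)); [|apply IH].
  intros x _. apply (is_derive_const c x).
Qed.

Lemma class_C_id (D : R -> Prop) (HD : open D) (n : nat) :
  class_C n D (fun x => x).
Proof.
destruct n as [|n].
- intros x _. apply continuous_id.
- apply (class_C_is_derive D HD n _ (fun _ => 1)).
  + intros x _. apply (is_derive_id x).
  + now apply class_C_const.
Qed.

Lemma class_C_plus (D : R -> Prop) (HD : open D) (n : nat) :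
  forall f g, class_C n D f -> class_C n D g ->
  class_C n D (fun x => f x + g x).
Proof.
induction n as [|n IH]; intros f g Hf Hg.
- intros x Hx. apply (continuous_plus f g x); [now apply Hf | now apply Hg].
- apply (class_C_is_derive D HD n _ (fun x => Derive f x + Derive g x)).
  + intros x Hx.
    apply (is_derive_plus f g x); apply Derive_correct;
      [now apply Hf | now apply Hg].
  + apply IH; [apply Hf | apply Hg].
Qed.

Lemma class_C_mult (D : R -> Prop) (HD : open D) (n : nat) :
  forall f g, class_C n D f -> class_C n D g ->
  class_C n D (fun x => f x * g x).
Proof.
induction n as [|n IH]; intros f g Hf Hg.
- intros x Hx. apply (continuous_mult f g x); [now apply Hf | now apply Hg].
- apply (class_C_is_derive D HD n _
           (fun x => Derive f x * g x + f x * Derive g x)).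
  + intros x Hx.
    apply (is_derive_mult f g x);
      [apply Derive_correct; now apply Hf
      |apply Derive_correct; now apply Hg
      |intros; apply Rmult_comm].
  + apply class_C_plus; [exact HD| |]; apply IH;
      try apply Hf; try apply Hg; now apply class_C_pred.
Qed.

Lemma class_C_inv (D : R -> Prop) (HD : open D) (n : nat) :
  forall f, (forall x, D x -> f x <> 0) -> class_C n D f ->
  class_C n D (fun x => / f x).
Proof.
induction n as [|n IH]; intros f Hnz Hf.
- intros x Hx. apply (continuous_comp f Rinv x); [now apply Hf|].
  apply continuity_pt_filterlim.
  apply continuity_pt_inv; [|now apply Hnz].
  apply derivable_continuous_pt, derivable_pt_id.
- apply (class_C_is_derive D HD n _
           (fun x => -1 * (Derive f x * (/ f x * / f x)))).
  + intros x Hx.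
    replace (-1 * (Derive f x * (/ f x * / f x)))
      with (- Derive f x / f x ^ 2) by (field; now apply Hnz).
    apply is_derive_inv; [apply Derive_correct; now apply Hf | now apply Hnz].
  + apply class_C_mult; [exact HD | now apply class_C_const|].
    apply class_C_mult; [exact HD | apply Hf|].
    apply class_C_mult; [exact HD | |]; apply IH; trivial;
      now apply class_C_pred.
Qed.

Lemma smooth2_continuous (g : R -> R -> R) (u v : R -> R) (x : R) :
  smooth2 g -> continuous u x -> continuous v x ->
  continuous (fun t => g (u t) (v t)) x.
Proof.
intros Hg Hu Hv.
apply (continuous_comp_2 u v g x Hu Hv).
apply (proj1 (continuity_2d_pt_filterlim g (u x) (v x))).
apply (Hg 0%nat).
Qed.

Lemma smooth2_partial_1 (g : R -> R -> R) :
  smooth2 g -> smooth2 (fun x y => Derive (fun z => g z y) x).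
Proof.
intros Hg n x y. apply ex_diff_n_deriv_aux1, Hg.
Qed.

Lemma smooth2_partial_2 (g : R -> R -> R) :
  smooth2 g -> smooth2 (fun x y => Derive (fun z => g x z) y).
Proof.
intros Hg n x y. apply ex_diff_n_deriv_aux2, Hg.
Qed.

(** The continuity of the first partial derivative makes [g] differentiable in
    the sense of Frechet, which the chain rule needs. *)
Lemma smooth2_chain (g : R -> R -> R) (u v : R -> R) (x : R) :
  smooth2 g -> ex_derive u x -> ex_derive v x ->
  is_derive (fun t => g (u t) (v t)) x
    (Derive (fun z => g z (v x)) (u x) * Derive u x
     + Derive (fun z => g (u x) z) (v x) * Derive v x).
Proof.
intros Hg Hu Hv.
apply is_derive_Reals, derivable_pt_lim_comp_2d.
- apply (proj1 (filterdiff_differentiable_pt_lim g (u x) (v x) _ _)).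
  apply (is_derive_filterdiff g (u x) (v x)
           (fun a b => Derive (fun z => g z b) a)).
  + apply filter_forall. intros [a b]. apply Derive_correct.
    exact (proj1 (proj2 (Hg 1%nat a b))).
  + apply Derive_correct. exact (proj1 (proj2 (proj2 (Hg 1%nat (u x) (v x))))).
  + apply (proj1 (continuity_2d_pt_filterlim
      (fun a b => Derive (fun z => g z b) a) (u x) (v x))).
    apply (smooth2_partial_1 g Hg 0%nat).
- now apply is_derive_Reals, Derive_correct.
- now apply is_derive_Reals, Derive_correct.
Qed.

Lemma class_C_comp2 (D : R -> Prop) (HD : open D) (n : nat) :
  forall (g : R -> R -> R) (u v : R -> R),
  smooth2 g -> class_C n D u -> class_C n D v ->
  class_C n D (fun x => g (u x) (v x)).
Proof.
induction n as [|n IH]; intros g u v Hg Hu Hv.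
- intros x Hx. apply smooth2_continuous; auto.
- pose proof (class_C_pred D n u Hu) as Hu'.
  pose proof (class_C_pred D n v Hv) as Hv'.
  eapply (class_C_is_derive D HD).
  + intros x Hx. apply smooth2_chain; [exact Hg | now apply Hu | now apply Hv].
  + apply class_C_plus; [exact HD| |]; apply class_C_mult; trivial.
    * apply (IH (fun x y => Derive (fun z => g z y) x)); trivial.
      now apply smooth2_partial_1.
    * apply Hu.
    * apply (IH (fun x y => Derive (fun z => g x z) y)); trivial.
      now apply smooth2_partial_2.
    * apply Hv.
Qed.

(** [Derive_n] differentiates from the outside.  To exchange the two orders all
    classes are needed at once. *)
Lemma class_C_ex_derive_n (D : R -> Prop) (f : R -> R) :
  (forall n, class_C n D f) -> forall n x, D x -> ex_derive_n f n x.
Proof.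
intros Hf.
assert (Hiter : forall m n, class_C n D (Derive_n f m)).
{ induction m as [|m IH]; intros n; [apply Hf|]. apply (IH (S n)). }
intros [|n] x Hx; [exact I|].
now apply (Hiter n 1%nat).
Qed.

(** * Primitives and the normalised Gaussian *)

Lemma ex_RInt_of_continuous (f : R -> R) (a b : R) :
  (forall x, continuous f x) -> ex_RInt f a b.
Proof.
intros Hf. apply (ex_RInt_continuous f a b). intros z _. apply Hf.
Qed.

Lemma is_derive_primitive (f : R -> R) (a x : R) :
  (forall x, continuous f x) -> is_derive (fun y => RInt f a y) x (f x).
Proof.
intros Hf. apply (is_derive_RInt f (fun y => RInt f a y) a x); [|apply Hf].
apply filter_forall. intros y.
apply (RInt_correct f a y). now apply ex_RInt_of_continuous.
Qed.

Lemma continuous_of_is_derive (f : R -> R) (x l : R) :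
  is_derive f x l -> continuous f x.
Proof.
intros Hf.
apply (ex_derive_continuous (K := R_AbsRing) (V := R_NormedModule) f x).
now exists l.
Qed.

Lemma continuous_primitive (f : R -> R) (a x : R) :
  (forall x, continuous f x) -> continuous (fun y => RInt f a y) x.
Proof.
intros Hf. now apply continuous_of_is_derive with (f x), is_derive_primitive.
Qed.

Lemma RInt_minus_start (f : R -> R) (a x y : R) :
  (forall x, continuous f x) -> RInt f a y - RInt f a x = RInt f x y.
Proof.
intros Hf.
rewrite <- (RInt_Chasles f a x y) by now apply ex_RInt_of_continuous.
unfold plus; simpl; ring.
Qed.

Lemma RInt_nonneg_of_continuous (f : R -> R) (a b : R) :
  (forall x, continuous f x) -> a <= b -> (forall x, a <= x <= b -> 0 <= f x) ->
  0 <= RInt f a b.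
Proof.
intros Hf Hab Hpos. apply RInt_ge_0; [exact Hab| |].
- now apply ex_RInt_of_continuous.
- intros x Hx. apply Hpos. lra.
Qed.

Lemma is_lim_bounded_increasing (f : R -> R) (B : R) :
  (forall x y, x <= y -> f x <= f y) -> (forall x, f x <= B) ->
  exists l : R, is_lim f p_infty l /\ forall x, f x <= l.
Proof.
intros Hinc HB.
destruct (completeness (fun y => exists x, y = f x)) as [l [Hub Hlub]].
- exists B. intros y [x ->]. apply HB.
- exists (f 0). now exists 0.
- exists l.
  assert (Hle : forall x, f x <= l) by (intros x; apply Hub; now exists x).
  split; [|exact Hle].
  intros P [e He].
  assert (Hx0 : exists x0, l - e < f x0).
  { apply Classical_Prop.NNPP. intros Hno.
    assert (l <= l - e); [|pose proof (cond_pos e); lra].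
    apply Hlub. intros y [x ->].
    destruct (Rle_or_lt (f x) (l - e)) as [H|H]; [exact H|].
    exfalso. apply Hno. now exists x. }
  destruct Hx0 as [x0 Hx0]. exists x0. intros x Hx. apply He.
  pose proof (Hinc x0 x (Rlt_le _ _ Hx)). pose proof (Hle x).
  unfold ball; simpl; unfold AbsRing_ball, abs, minus, plus, opp; simpl.
  apply Rabs_def1; lra.
Qed.

Definition gauss (c z : R) : R := exp (- z ^ 2 / (2 * c)).

Definition gauss_primitive (c x : R) : R := RInt (gauss c) 0 x.

Lemma is_derive_gauss (c x : R) :
  0 < c -> is_derive (gauss c) x (- x / c * gauss c x).
Proof.
intros Hc. unfold gauss at 1. auto_derive; [lra|].
change (exp (- (x * (x * 1)) * / (2 * c))) with (gauss c x). field. lra.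
Qed.

Lemma continuous_gauss (c x : R) : 0 < c -> continuous (gauss c) x.
Proof.
intros Hc. now apply continuous_of_is_derive with (1 := is_derive_gauss c x Hc).
Qed.

Lemma gauss_primitive_odd (c x : R) :
  0 < c -> gauss_primitive c (- x) = - gauss_primitive c x.
Proof.
intros Hc. unfold gauss_primitive.
replace (RInt (gauss c) 0 (- x)) with (RInt (gauss c) (- 0) (- x))
  by (now rewrite Ropp_0).
assert (Hcont : forall y, continuous (gauss c) y)
  by (intros; now apply continuous_gauss).
rewrite <- (RInt_comp (gauss c) Ropp (fun _ => -1) 0 x).
- transitivity (scal (-1) (RInt (gauss c) 0 x)).
  2: { unfold scal; simpl; unfold mult; simpl. ring. }
  rewrite <- (RInt_scal (gauss c) 0 x (-1))
    by now apply ex_RInt_of_continuous.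
  apply RInt_ext.
  intros y _. unfold gauss. do 3 f_equal. ring.
- intros y _. apply Hcont.
- intros y _. split; [auto_derive; [exact I | ring] | apply continuous_const].
Qed.

Lemma gauss_primitive_increasing (c x y : R) :
  0 < c -> x <= y -> gauss_primitive c x <= gauss_primitive c y.
Proof.
intros Hc Hxy. unfold gauss_primitive.
assert (Hcont : forall x, continuous (gauss c) x)
  by (intros; now apply continuous_gauss).
pose proof (RInt_minus_start (gauss c) 0 x y Hcont) as H.
assert (0 <= RInt (gauss c) x y); [|lra].
apply RInt_nonneg_of_continuous; trivial.
intros z _. apply Rlt_le, exp_pos.
Qed.

(** Since (z - c)^2 >= 0, the Gaussian lies below exp (c / 2 - z), which has an
    explicit primitive. *)
Lemma gauss_primitive_bounded (c x : R) :
  0 < c -> gauss_primitive c x <= exp (c / 2).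
Proof.
intros Hc.
apply Rle_trans with (gauss_primitive c (Rmax 0 x)).
{ apply gauss_primitive_increasing; [exact Hc | apply Rmax_r]. }
set (y := Rmax 0 x). assert (Hy : 0 <= y) by apply Rmax_l.
assert (HI : is_RInt (fun z => exp (c / 2 - z)) 0 y
               (minus (- exp (c / 2 - y)) (- exp (c / 2 - 0)))).
{ apply (is_RInt_derive (fun z => - exp (c / 2 - z))).
  - intros z _. auto_derive; [exact I|]. unfold Rminus, Rdiv. ring.
  - intros z _. apply (continuous_of_is_derive _ _ (- exp (c / 2 - z))).
    auto_derive; [exact I|]. unfold Rminus, Rdiv. ring. }
apply Rle_trans with (RInt (fun z => exp (c / 2 - z)) 0 y).
- apply RInt_le; [exact Hy| |now eexists; apply HI|].
  + apply ex_RInt_of_continuous. intros; now apply continuous_gauss.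
  + intros z _. unfold gauss.
    assert (H : - z ^ 2 / (2 * c) <= c / 2 - z).
    { assert (0 <= (z - c) ^ 2 / (2 * c)).
      { apply Rmult_le_pos; [apply pow2_ge_0|].
        apply Rlt_le, Rinv_0_lt_compat; lra. }
      replace (c / 2 - z) with ((z - c) ^ 2 / (2 * c) + - z ^ 2 / (2 * c));
        [lra|field; lra]. }
    destruct H as [H| ->]; [now apply Rlt_le, exp_increasing | lra].
- rewrite (is_RInt_unique _ _ _ _ HI).
  unfold minus, plus, opp; simpl. rewrite Rminus_0_r.
  pose proof (exp_pos (c / 2 - y)). lra.
Qed.

Lemma gauss_primitive_limit (c : R) :
  0 < c ->
  exists L : R, 0 < L /\
    is_lim (gauss_primitive c) p_infty L /\
    is_lim (gauss_primitive c) m_infty (- L) /\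
    forall x, - L <= gauss_primitive c x <= L.
Proof.
intros Hc.
destruct (is_lim_bounded_increasing (gauss_primitive c) (exp (c / 2)))
  as (L & Hlim & Hle).
{ intros; now apply gauss_primitive_increasing. }
{ intros; now apply gauss_primitive_bounded. }
exists L. split; [|split; [exact Hlim|split]].
- apply Rlt_le_trans with (2 := Hle 1). apply RInt_gt_0; [lra| |].
  + intros z _. apply exp_pos.
  + intros z _. now apply continuous_gauss.
- apply is_lim_ext with (fun x => - gauss_primitive c (- x)).
  { intros x. rewrite gauss_primitive_odd by exact Hc. ring. }
  apply (is_lim_opp (fun x => gauss_primitive c (- x)) m_infty L).
  apply (is_lim_comp (gauss_primitive c) Ropp m_infty L p_infty).
  + exact Hlim.
  + apply (is_lim_opp (fun x : R => x) m_infty m_infty), is_lim_id.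
  + now exists 0.
- intros x. split; [|apply Hle].
  pose proof (Hle (- x)) as H. rewrite gauss_primitive_odd in H by exact Hc.
  lra.
Qed.

Lemma is_RInt_gen_gauss (c la lb : R) (Fa Fb : (R -> Prop) -> Prop)
    (FFa : Filter Fa) (FFb : Filter Fb) :
  0 < c ->
  filterlim (gauss_primitive c) Fa (locally la) ->
  filterlim (gauss_primitive c) Fb (locally lb) ->
  is_RInt_gen (gauss c) Fa Fb (lb - la).
Proof.
intros Hc Ha Hb.
assert (HD : forall x, is_derive (gauss_primitive c) x (gauss c x)).
{ intros x. apply is_derive_primitive. intros; now apply continuous_gauss. }
apply is_RInt_gen_ext with (Derive (gauss_primitive c)).
{ apply filter_forall. intros ab x _. now apply is_derive_unique. }
apply is_RInt_gen_Derive; trivial; apply filter_forall; intros ab x _.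
- now exists (gauss c x).
- apply continuous_ext with (gauss c).
  + intros y. symmetry. now apply is_derive_unique.
  + now apply continuous_gauss.
Qed.

(** With L the limit of the odd primitive F of the Gaussian, v = F / L.  The
    Gaussian g satisfies c g' = - x g, which is the equation for v' and also
    shows, by induction, that g is smooth. *)
Lemma viscous_layer (c : R) :
  0 < c ->
  exists v : R -> R,
    (forall x, - x * Derive v x = c * Derive_n v 2 x) /\
    is_lim v m_infty (-1) /\ is_lim v p_infty 1 /\
    (forall n, class_C n (fun _ => True) v) /\
    (forall x, -1 <= v x <= 1) /\
    (forall x y, x <= y -> v x <= v y) /\
    (forall x, v x = -1 + 2 *
       (RInt_gen (gauss c) (Rbar_locally m_infty) (at_point x) /
        RInt_gen (gauss c) (Rbar_locally m_infty) (Rbar_locally p_infty))).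
Proof.
intros Hc.
destruct (gauss_primitive_limit c Hc) as (L & HL & Hp & Hm & Hbd).
exists (fun x => / L * gauss_primitive c x).
assert (HD : forall x, is_derive (fun x : R => / L * gauss_primitive c x) x
                         (/ L * gauss c x)).
{ intros x. apply (is_derive_scal (gauss_primitive c) x (/ L)).
  apply is_derive_primitive. intros; now apply continuous_gauss. }
assert (HD2 : forall x, is_derive (fun x : R => / L * gauss c x) x
                         (/ L * (- x / c * gauss c x))).
{ intros x. apply (is_derive_scal (gauss c) x (/ L)). now apply is_derive_gauss. }
assert (HLi : 0 < / L) by now apply Rinv_0_lt_compat.
split; [|split; [|split; [|split; [|split; [|split]]]]].
- intros x. pose proof (fun y => is_derive_unique _ _ _ (HD y)) as E1.
  pose proof (is_derive_unique _ _ _ (HD2 x)) as E2.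
  simpl. cbv beta in E1, E2. rewrite E1.
  transitivity (c * Derive (fun x : R => / L * gauss c x) x).
  { rewrite E2. field. lra. }
  f_equal. apply Derive_ext. intros y. symmetry. apply E1.
- replace (Finite (-1)) with (Rbar_mult (/ L) (- L))
    by (simpl; f_equal; field; lra).
  now apply is_lim_scal_l.
- replace (Finite 1) with (Rbar_mult (/ L) L)
    by (simpl; f_equal; field; lra).
  now apply is_lim_scal_l.
- assert (HT : open (fun _ : R => True)) by apply open_true.
  assert (Hg : forall n, class_C n (fun _ => True) (gauss c)).
  { induction n as [|n IH].
    - intros x _. now apply continuous_gauss.
    - apply (class_C_is_derive _ HT n _ (fun x => (x * (- / c)) * gauss c x)).
      + intros x _. replace (x * - / c) with (- x / c) by (field; lra).
        now apply is_derive_gauss.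
      + apply class_C_mult; trivial. apply class_C_mult; trivial.
        * now apply class_C_id.
        * now apply class_C_const. }
  intros [|n].
  + intros x _. now apply continuous_of_is_derive with (1 := HD x).
  + apply (class_C_is_derive _ HT n _ (fun x => / L * gauss c x)).
    * intros x _. apply HD.
    * apply class_C_mult; trivial. now apply class_C_const.
- intros x. pose proof (Hbd x) as [H1 H2].
  apply (Rmult_le_compat_l (/ L)) in H1; [|lra].
  apply (Rmult_le_compat_l (/ L)) in H2; [|lra].
  replace (/ L * - L) with (-1) in H1 by (field; lra).
  replace (/ L * L) with 1 in H2 by (field; lra). lra.
- intros x y Hxy. apply Rmult_le_compat_l; [lra|].
  now apply gauss_primitive_increasing.
- intros x.
  assert (Hx : filterlim (gauss_primitive c) (at_point x)
                 (locally (gauss_primitive c x))).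
  { intros P HP. exact (locally_singleton _ _ HP). }
  rewrite (is_RInt_gen_unique _ _
    (is_RInt_gen_gauss c (- L) (gauss_primitive c x)
       (Rbar_locally m_infty) (at_point x) _ _ Hc Hm Hx)).
  rewrite (is_RInt_gen_unique _ _
    (is_RInt_gen_gauss c (- L) L
       (Rbar_locally m_infty) (Rbar_locally p_infty) _ _ Hc Hm Hp)).
  field. lra.
Qed.

(** * Picard iteration in a weighted sup norm *)

(** [T] divides by two the distance in the norm with weight [V].  The distance
    is expressed by an upper bound [D], which spares a supremum. *)
Definition halving (V : R -> R) (T : (R -> R) -> R -> R) : Prop :=
  forall (r s : R -> R) (D : R),
  (forall x, continuous r x) -> (forall x, continuous s x) -> 0 <= D ->
  (forall x, Rabs (r x - s x) <= D * V x) ->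
  forall x, Rabs (T r x - T s x) <= D / 2 * V x.

(** Starting the iteration at 0 makes the fixed point a definite function of
    [T], hence of the parameters of [T]. *)
Definition picard_limit (T : (R -> R) -> R -> R) (x : R) : R :=
  Lim_seq (fun n => Nat.iter n T (fun _ => 0) x).

Lemma half_pow_small (C e : R) :
  0 < e -> exists N, forall n, (N <= n)%nat -> C * (/ 2) ^ n < e.
Proof.
intros He.
assert (Hlim : is_lim_seq (fun n => C * (/ 2) ^ n) (C * 0)).
{ apply (is_lim_seq_scal_l (fun n => (/ 2) ^ n) C 0).
  apply is_lim_seq_geom. rewrite Rabs_pos_eq; lra. }
rewrite Rmult_0_r in Hlim. apply is_lim_seq_spec in Hlim.
destruct (Hlim (mkposreal e He)) as [N HN]. exists N. intros n Hn.
specialize (HN n Hn). simpl in HN. apply Rabs_def2 in HN. lra.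
Qed.

Lemma half_pow_pos (n : nat) : 0 < (/ 2) ^ n.
Proof. apply pow_lt. lra. Qed.

(** Banach's fixed point theorem: the increments of the iteration decrease like
    (1/2)^n uniformly, because the weight is bounded. *)
Lemma picard_limit_fixed (V : R -> R) (W D : R) (T : (R -> R) -> R -> R) :
  (forall x, 0 <= V x <= W) -> halving V T ->
  (forall r, (forall x, continuous r x) -> forall x, continuous (T r) x) ->
  0 <= D -> (forall x, Rabs (T (fun _ => 0) x) <= D * V x) ->
  (forall x, continuous (picard_limit T) x) /\
  (forall x, T (picard_limit T) x = picard_limit T x).
Proof.
intros HV HT Hcont HD H0.
set (u := fun n => Nat.iter n T (fun _ => 0)).
assert (Hu : forall n x, continuous (u n) x).
{ induction n as [|n IH]; intros x; [apply continuous_const|].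
  now apply (Hcont (u n)). }
assert (Hstep : forall n x,
  Rabs (u (S n) x - u n x) <= (D * (/ 2) ^ n) * V x).
{ induction n as [|n IH]; intros x.
  - unfold u; simpl. rewrite Rminus_0_r, Rmult_1_r. apply H0.
  - replace (D * (/ 2) ^ S n) with (D * (/ 2) ^ n / 2) by (simpl; field).
    apply (HT (u (S n)) (u n)); auto.
    pose proof (half_pow_pos n). apply Rmult_le_pos; lra. }
assert (Htail : forall n m x,
  Rabs (u (m + n)%nat x - u n x)
  <= 2 * D * ((/ 2) ^ n - (/ 2) ^ (m + n)) * V x).
{ intros n m x. induction m as [|m IH].
  - simpl. rewrite !Rminus_diag, Rabs_R0. lra.
  - change (S m + n)%nat with (S (m + n)).
    replace (u (S (m + n)) x - u n x)
      with ((u (S (m + n)) x - u (m + n)%nat x) + (u (m + n)%nat x - u n x))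
      by ring.
    eapply Rle_trans; [apply Rabs_triang|].
    pose proof (Hstep (m + n)%nat x). simpl pow. lra. }
assert (HW : 0 <= W) by (pose proof (HV 0); lra).
assert (Htail' : forall n m x, (n <= m)%nat ->
  Rabs (u m x - u n x) <= 2 * D * (/ 2) ^ n * V x).
{ intros n m x Hnm. replace m with ((m - n) + n)%nat by lia.
  eapply Rle_trans; [apply Htail|].
  apply Rmult_le_compat_r; [apply HV|].
  pose proof (half_pow_pos (m - n + n)).
  apply Rmult_le_compat_l; lra. }
assert (Hunif : forall n m x, (n <= m)%nat ->
  Rabs (u m x - u n x) <= 2 * D * W * (/ 2) ^ n).
{ intros n m x Hnm. eapply Rle_trans; [now apply Htail'|].
  replace (2 * D * W * (/ 2) ^ n) with (2 * D * (/ 2) ^ n * W) by ring.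
  apply Rmult_le_compat_l; [|apply HV].
  pose proof (half_pow_pos n). apply Rmult_le_pos; lra. }
assert (Hlim : forall x, is_lim_seq (fun n => u n x) (picard_limit T x)).
{ intros x. apply Lim_seq_correct', ex_lim_seq_cauchy_corr.
  intros e.
  destruct (half_pow_small (2 * D * W) (e / 2)) as [N HN].
  { pose proof (cond_pos e); lra. }
  exists N. intros n m Hn Hm.
  pose proof (Hunif N n x Hn). pose proof (Hunif N m x Hm).
  pose proof (HN N (Nat.le_refl N)).
  replace (u n x - u m x) with ((u n x - u N x) - (u m x - u N x)) by ring.
  apply Rle_lt_trans with (1 := Rabs_triang _ _). rewrite Rabs_Ropp. lra. }
assert (Herr : forall n x,
  Rabs (picard_limit T x - u n x) <= 2 * D * (/ 2) ^ n * V x).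
{ intros n x.
  apply (is_lim_seq_le (fun m => Rabs (u (m + n)%nat x - u n x))
           (fun _ => 2 * D * (/ 2) ^ n * V x)
           (Rabs (picard_limit T x - u n x)) (2 * D * (/ 2) ^ n * V x)).
  - intros m. apply Htail'. lia.
  - apply (is_lim_seq_abs _ (picard_limit T x - u n x)).
    apply is_lim_seq_minus'.
    + now apply -> (is_lim_seq_incr_n (fun m => u m x) n).
    + apply is_lim_seq_const.
  - apply is_lim_seq_const. }
assert (Herr' : forall n x,
  Rabs (picard_limit T x - u n x) <= 2 * D * W * (/ 2) ^ n).
{ intros n x. eapply Rle_trans; [now apply Herr|].
  replace (2 * D * W * (/ 2) ^ n) with (2 * D * (/ 2) ^ n * W) by ring.
  apply Rmult_le_compat_l; [|apply HV].
  pose proof (half_pow_pos n). apply Rmult_le_pos; lra. }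
assert (Hpc : forall x, continuous (picard_limit T) x).
{ intros x. apply filterlim_locally. intros e.
  destruct (half_pow_small (2 * D * W) (e / 3)) as [N HN].
  { pose proof (cond_pos e); lra. }
  assert (He3 : 0 < e / 3) by (pose proof (cond_pos e); lra).
  pose proof (proj1 (filterlim_locally _ _) (Hu N x) (mkposreal _ He3)) as Hloc.
  revert Hloc. apply filter_imp. intros y Hy.
  change (Rabs (u N y - u N x) < e / 3) in Hy.
  change (Rabs (picard_limit T y - picard_limit T x) < e).
  pose proof (Herr' N y). pose proof (Herr' N x).
  pose proof (HN N (Nat.le_refl N)).
  replace (picard_limit T y - picard_limit T x)
    with ((picard_limit T y - u N y) + ((u N y - u N x)
          - (picard_limit T x - u N x))) by ring.
  apply Rle_lt_trans with (1 := Rabs_triang _ _).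
  assert (Rabs ((u N y - u N x) - (picard_limit T x - u N x))
          <= Rabs (u N y - u N x) + Rabs (picard_limit T x - u N x)).
  { unfold Rminus at 1. eapply Rle_trans; [apply Rabs_triang|].
    rewrite Rabs_Ropp. lra. }
  lra. }
split; [exact Hpc|].
intros x. apply Rminus_diag_uniq.
apply Rabs_eq_0, Rle_antisym; [|apply Rabs_pos].
apply le_epsilon. intros e He.
destruct (half_pow_small (2 * D * W) e He) as [N HN].
specialize (HN N (Nat.le_refl N)).
assert (HDN : 0 <= 2 * D * (/ 2) ^ N).
{ pose proof (half_pow_pos N). apply Rmult_le_pos; lra. }
pose proof (HT (picard_limit T) (u N) _ Hpc (Hu N) HDN (Herr N) x) as H1.
pose proof (Herr' (S N) x) as H2. simpl pow in H2.
change (T (u N) x) with (u (S N) x) in H1.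
replace (T (picard_limit T) x - picard_limit T x)
  with ((T (picard_limit T) x - u (S N) x) - (picard_limit T x - u (S N) x))
  by ring.
unfold Rminus at 1. eapply Rle_trans; [apply Rabs_triang|]. rewrite Rabs_Ropp.
assert (2 * D * (/ 2) ^ N / 2 * V x <= 2 * D * (/ 2) ^ N / 2 * W).
{ apply Rmult_le_compat_l; [lra | apply HV]. }
lra.
Qed.

(** Stability of fixed points: from |r - s| <= D V one gets
    |r - s| <= |T r - T s| + |T s - s| <= (D / 2 + d) V, and iterating this
    drives the bound to 2 d V.  Applied to the fixed points for two values of
    a parameter, it yields continuity in the parameter. *)
Lemma almost_fixed_close (V : R -> R) (T : (R -> R) -> R -> R)
    (r s : R -> R) (D d : R) :
  halving V T -> (forall x, 0 <= V x) ->
  (forall x, continuous r x) -> (forall x, continuous s x) ->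
  0 <= D -> 0 <= d ->
  (forall x, Rabs (r x - s x) <= D * V x) ->
  (forall x, T r x = r x) -> (forall x, Rabs (T s x - s x) <= d * V x) ->
  forall x, Rabs (r x - s x) <= 2 * d * V x.
Proof.
intros HT HV Hr Hs HD Hd Hrs Hfix Hs' x.
assert (H : forall n x, Rabs (r x - s x) <= (D * (/ 2) ^ n + 2 * d) * V x).
{ induction n as [|n IH]; intros y.
  - eapply Rle_trans; [apply Hrs|]. apply Rmult_le_compat_r; [apply HV|].
    simpl; lra.
  - assert (Hn : 0 <= D * (/ 2) ^ n + 2 * d).
    { pose proof (half_pow_pos n).
      assert (0 <= D * (/ 2) ^ n) by (apply Rmult_le_pos; lra). lra. }
    pose proof (HT r s _ Hr Hs Hn IH y) as H1. rewrite Hfix in H1.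
    replace (r y - s y) with ((r y - T s y) + (T s y - s y)) by ring.
    eapply Rle_trans; [apply Rabs_triang|]. pose proof (Hs' y).
    simpl pow. lra. }
apply le_epsilon. intros e He.
destruct (half_pow_small (D * V x) e He) as [N HN].
specialize (HN N (Nat.le_refl N)). pose proof (H N x). lra.
Qed.

(** * A nonlocal Volterra equation with a free slope *)

Definition clip (lo hi x : R) : R := Rmax lo (Rmin hi x).

Lemma clip_range (lo hi x : R) : lo <= hi -> lo <= clip lo hi x <= hi.
Proof.
intros H. unfold clip, Rmax, Rmin.
destruct (Rle_dec hi x); destruct (Rle_dec lo _); lra.
Qed.

Lemma clip_id (lo hi x : R) : lo <= x <= hi -> clip lo hi x = x.
Proof.
intros H. unfold clip, Rmax, Rmin.
destruct (Rle_dec hi x); destruct (Rle_dec lo _); lra.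
Qed.

Lemma clip_lipschitz (lo hi x y : R) :
  Rabs (clip lo hi x - clip lo hi y) <= Rabs (x - y).
Proof.
unfold clip, Rmax, Rmin, Rabs.
destruct (Rle_dec hi x), (Rle_dec hi y);
  repeat match goal with
  | |- context [Rle_dec lo ?t] => destruct (Rle_dec lo t)
  | |- context [Rcase_abs ?t] => destruct (Rcase_abs t)
  end; lra.
Qed.

Lemma continuous_of_lipschitz (f : R -> R) (K x : R) :
  (forall y z, Rabs (f y - f z) <= K * Rabs (y - z)) -> continuous f x.
Proof.
intros Hf. apply filterlim_locally. intros e.
assert (HK : 0 < Rabs K + 1) by (pose proof (Rabs_pos K); lra).
assert (Hd : 0 < e / (Rabs K + 1)).
{ apply Rdiv_lt_0_compat; [apply cond_pos | exact HK]. }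
exists (mkposreal _ Hd). intros y Hy.
change (Rabs (y - x) < e / (Rabs K + 1)) in Hy.
change (Rabs (f y - f x) < e).
eapply Rle_lt_trans; [apply Hf|].
apply Rle_lt_trans with ((Rabs K + 1) * Rabs (y - x)).
- apply Rmult_le_compat_r; [apply Rabs_pos|]. pose proof (Rle_abs K); lra.
- apply (Rmult_lt_compat_l (Rabs K + 1)) in Hy; [|exact HK].
  replace ((Rabs K + 1) * (e / (Rabs K + 1))) with (pos e) in Hy
    by (field; lra). exact Hy.
Qed.

Lemma continuous_clip (lo hi x : R) : continuous (clip lo hi) x.
Proof.
apply continuous_of_lipschitz with 1. intros y z. rewrite Rmult_1_l.
apply clip_lipschitz.
Qed.

Lemma cosh_ge_1 (t : R) : 1 <= cosh t.
Proof.
unfold cosh. pose proof (exp_ineq1_le t). pose proof (exp_ineq1_le (- t)). lra.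
Qed.

Lemma cosh_le_exp_Rabs (t : R) : cosh t <= exp (Rabs t).
Proof.
assert (H : forall s, s <= Rabs t -> exp s <= exp (Rabs t)).
{ intros s [Hs| ->]; [now apply Rlt_le, exp_increasing | lra]. }
unfold cosh. pose proof (H t (Rle_abs t)).
assert (- t <= Rabs t) by (rewrite <- Rabs_Ropp; apply Rle_abs).
pose proof (H (- t) ltac:(lra)). lra.
Qed.

Lemma Rabs_sinh_le_cosh (t : R) : Rabs (sinh t) <= cosh t.
Proof.
unfold sinh, cosh. pose proof (exp_pos t). pose proof (exp_pos (- t)).
apply Rabs_le. lra.
Qed.

Lemma exp_le_compat (s t : R) : s <= t -> exp s <= exp t.
Proof. intros [H| ->]; [now apply Rlt_le, exp_increasing | lra]. Qed.

Lemma exp_lipschitz (B s t : R) :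
  s <= B -> t <= B -> Rabs (exp s - exp t) <= exp B * Rabs (s - t).
Proof.
intros Hs Ht.
destruct (MVT_gen exp t s exp) as (c & Hc & ->).
- intros x _. apply is_derive_exp.
- intros x _. apply derivable_continuous_pt, derivable_pt_exp.
- rewrite Rabs_mult. apply Rmult_le_compat_r; [apply Rabs_pos|].
  rewrite Rabs_pos_eq by (apply Rlt_le, exp_pos).
  apply exp_le_compat. destruct Hc as [_ Hc].
  apply Rle_trans with (1 := Hc). now apply Rmax_lub.
Qed.

(** Integration gains the factor 1 / k on the weight cosh (k (x - a)), whose
    primitive sinh (k (x - a)) / k it dominates.  The hyperbolic cosine, unlike
    an exponential, serves both sides of [a]. *)
Lemma RInt_le_cosh (f : R -> R) (k c a x : R) :
  0 < k -> 0 <= c -> (forall z, continuous f z) ->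
  (forall z, Rmin a x <= z <= Rmax a x ->
     Rabs (f z) <= c * cosh (k * (z - a))) ->
  Rabs (RInt f a x) <= c / k * cosh (k * (x - a)).
Proof.
intros Hk Hc Hf Hb.
assert (HI : forall y y', is_RInt (fun z => c * cosh (k * (z - a))) y y'
  (minus (c / k * sinh (k * (y' - a))) (c / k * sinh (k * (y - a))))).
{ intros y y'. apply (is_RInt_derive (fun z => c / k * sinh (k * (z - a)))).
  - intros z _. unfold sinh, cosh. auto_derive; [exact I|].
    unfold Rminus, Rdiv. field. lra.
  - intros z _.
    apply (continuous_of_is_derive _ _ (c * k * sinh (k * (z - a)))).
    unfold sinh, cosh. auto_derive; [exact I|].
    unfold Rminus, Rdiv. field. }
assert (Hck : 0 <= c / k).
{ apply Rmult_le_pos; [exact Hc | now apply Rlt_le, Rinv_0_lt_compat]. }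
assert (H0 : sinh (k * (a - a)) = 0).
{ rewrite Rminus_diag, Rmult_0_r. apply sinh_0. }
pose proof (Rabs_sinh_le_cosh (k * (x - a))) as Hs.
apply (Rmult_le_compat_l (c / k) _ _ Hck) in Hs.
assert (Hfi : forall y y', is_RInt f y y' (RInt f y y')).
{ intros y y'. apply (RInt_correct f y y'). now apply ex_RInt_of_continuous. }
destruct (Rle_or_lt a x) as [Hax|Hax].
- rewrite Rmin_left, Rmax_right in Hb by exact Hax.
  pose proof (norm_RInt_le f _ a x _ _ Hax Hb (Hfi a x) (HI a x)) as H.
  change (norm (RInt f a x)) with (Rabs (RInt f a x)) in H.
  unfold minus, plus, opp in H; simpl in H. rewrite H0 in H.
  pose proof (Rle_abs (sinh (k * (x - a)))) as H1.
  apply (Rmult_le_compat_l (c / k) _ _ Hck) in H1. lra.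
- rewrite Rmin_right, Rmax_left in Hb by lra.
  pose proof (norm_RInt_le f _ x a _ _ (Rlt_le _ _ Hax) Hb
                (Hfi x a) (HI x a)) as H.
  change (norm (RInt f x a)) with (Rabs (RInt f x a)) in H.
  rewrite <- (opp_RInt_swap f x a) by now apply ex_RInt_of_continuous.
  unfold minus, plus, opp in *; simpl in *. rewrite H0 in H.
  rewrite Rabs_Ropp.
  pose proof (Rle_abs (- sinh (k * (x - a)))) as H1. rewrite Rabs_Ropp in H1.
  apply (Rmult_le_compat_l (c / k) _ _ Hck) in H1. lra.
Qed.

Lemma RInt_le_const (f : R -> R) (c l a x : R) :
  0 <= c -> (forall z, continuous f z) ->
  (forall z, Rmin a x <= z <= Rmax a x -> Rabs (f z) <= c) ->
  Rabs (x - a) <= l ->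
  Rabs (RInt f a x) <= c * l.
Proof.
intros Hc Hf Hb Hl.
apply Rle_trans with (c * Rabs (x - a)); [|now apply Rmult_le_compat_l].
destruct (Rle_or_lt a x) as [Hax|Hax].
- rewrite Rmin_left, Rmax_right in Hb by exact Hax.
  rewrite (Rabs_pos_eq (x - a)) by lra. rewrite Rmult_comm.
  apply abs_RInt_le_const; trivial. now apply ex_RInt_of_continuous.
- rewrite Rmin_right, Rmax_left in Hb by lra.
  rewrite <- (opp_RInt_swap f x a) by now apply ex_RInt_of_continuous.
  unfold opp; simpl. rewrite Rabs_Ropp.
  rewrite (Rabs_left (x - a)) by lra.
  replace (c * - (x - a)) with ((a - x) * c) by ring.
  apply abs_RInt_le_const; [lra| |trivial]. now apply ex_RInt_of_continuous.
Qed.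

(** Coefficients (r, x) |-> f r x of an integral equation for r: bounded and
    Lipschitz in r, with the same constant, for x in [lo, hi].  Continuity is
    only asked along graphs of continuous functions. *)
Definition tame (lo hi K : R) (f : R -> R -> R) : Prop :=
  (forall r : R -> R, (forall x, continuous r x) ->
     forall x, continuous (fun z => f (r z) z) x) /\
  (forall s t x, lo <= x <= hi ->
     Rabs (f s x) <= K /\ Rabs (f s x - f t x) <= K * Rabs (s - t)).

(** The right hand side for r' once the equation q = w' / w has been integrated:
    [beta] is 1 / B0 and the exponential is w. *)
Definition nonlocal_slope (beta q : R -> R -> R) (a : R) (r : R -> R)
    (x : R) : R :=
  beta (r x) x * exp (RInt (fun z => q (r z) z) a x).

Definition volterra (beta q : R -> R -> R) (a : R) (r : R -> R) (x : R) : R :=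
  RInt (nonlocal_slope beta q a r) a x.

Lemma between_range (lo hi a x z : R) :
  lo <= a <= hi -> lo <= x <= hi -> Rmin a x <= z <= Rmax a x ->
  lo <= z <= hi.
Proof.
intros Ha Hx [H1 H2]. split.
- apply Rle_trans with (2 := H1). apply Rmin_glb; lra.
- apply Rle_trans with (1 := H2). apply Rmax_lub; lra.
Qed.

Lemma Rabs_minus_le_length (lo hi a x : R) :
  lo <= a <= hi -> lo <= x <= hi -> Rabs (x - a) <= hi - lo.
Proof. intros Ha Hx. apply Rabs_le. lra. Qed.

Lemma continuous_exp_comp (f : R -> R) (x : R) :
  continuous f x -> continuous (fun y => exp (f y)) x.
Proof.
intros Hf. apply (continuous_comp f exp x Hf).
apply (continuous_of_is_derive exp _ _ (is_derive_exp (f x))).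
Qed.

Lemma continuous_nonlocal_slope (lo hi K a : R) (beta q : R -> R -> R)
    (r : R -> R) (x : R) :
  tame lo hi K beta -> tame lo hi K q -> (forall x, continuous r x) ->
  continuous (nonlocal_slope beta q a r) x.
Proof.
intros [Hb _] [Hq _] Hr. unfold nonlocal_slope.
apply (continuous_mult (fun x => beta (r x) x)
         (fun x => exp (RInt (fun z => q (r z) z) a x)) x).
- now apply Hb.
- apply continuous_exp_comp, continuous_primitive. now apply Hq.
Qed.

Lemma tame_exponent_le (lo hi K a : R) (q : R -> R -> R) (r : R -> R) (x : R) :
  0 <= K -> lo <= a <= hi -> tame lo hi K q -> (forall x, continuous r x) ->
  lo <= x <= hi ->
  Rabs (RInt (fun z => q (r z) z) a x) <= K * (hi - lo).
Proof.
intros HK Ha [Hqc Hq] Hr Hx.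
apply RInt_le_const; trivial.
- now apply Hqc.
- intros z Hz. apply (Hq (r z) (r z)). now apply between_range with a x.
- now apply Rabs_minus_le_length.
Qed.

Lemma nonlocal_slope_le (lo hi K a : R) (beta q : R -> R -> R)
    (r : R -> R) (x : R) :
  0 <= K -> lo <= a <= hi -> tame lo hi K beta -> tame lo hi K q ->
  (forall x, continuous r x) -> lo <= x <= hi ->
  Rabs (nonlocal_slope beta q a r x) <= K * exp (K * (hi - lo)).
Proof.
intros HK Ha Hb Hq Hr Hx. unfold nonlocal_slope. rewrite Rabs_mult.
apply Rmult_le_compat; try apply Rabs_pos.
- now apply (proj2 Hb (r x) (r x)).
- rewrite Rabs_pos_eq by (apply Rlt_le, exp_pos). apply exp_le_compat.
  apply Rle_trans with (1 := Rle_abs _). now apply tame_exponent_le.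
Qed.

Lemma volterra_le (lo hi K a : R) (beta q : R -> R -> R)
    (r : R -> R) (x : R) :
  0 <= K -> lo <= a <= hi -> tame lo hi K beta -> tame lo hi K q ->
  (forall x, continuous r x) -> lo <= x <= hi ->
  Rabs (volterra beta q a r x) <= K * exp (K * (hi - lo)) * (hi - lo).
Proof.
intros HK Ha Hb Hq Hr Hx. unfold volterra. apply RInt_le_const.
- apply Rmult_le_pos; [exact HK | apply Rlt_le, exp_pos].
- intros z. now apply (continuous_nonlocal_slope lo hi K).
- intros z Hz. apply nonlocal_slope_le; trivial.
  now apply between_range with a x.
- now apply Rabs_minus_le_length.
Qed.

Lemma volterra_lower_bound (lo hi K m a b : R) (beta q : R -> R -> R)
    (r : R -> R) :
  0 <= K -> 0 < m -> lo <= a <= hi -> a <= b <= hi ->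
  tame lo hi K beta -> tame lo hi K q ->
  (forall s x, lo <= x <= hi -> m <= beta s x) ->
  (forall x, continuous r x) ->
  (b - a) * (m * exp (- (K * (hi - lo)))) <= volterra beta q a r b.
Proof.
intros HK Hm Ha Hab Hb Hq Hmb Hr. unfold volterra.
replace ((b - a) * (m * exp (- (K * (hi - lo)))))
  with (RInt (fun _ => m * exp (- (K * (hi - lo)))) a b)
  by (rewrite RInt_const; reflexivity).
apply RInt_le; [apply Hab|apply ex_RInt_const| |].
- apply ex_RInt_of_continuous. intros z.
  now apply (continuous_nonlocal_slope lo hi K).
- intros z Hz. unfold nonlocal_slope.
  apply Rmult_le_compat; [lra|apply Rlt_le, exp_pos|apply Hmb; lra|].
  apply exp_le_compat.
  assert (H : Rabs (RInt (fun z => q (r z) z) a z) <= K * (hi - lo))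
    by (apply tame_exponent_le; trivial; lra).
  apply Rabs_le_between in H. lra.
Qed.

(** The difference of the exponents is an integral and is controlled by
    [RInt_le_cosh]; the exponents are bounded by K (hi - lo), where the
    exponential is Lipschitz. *)
Lemma nonlocal_slope_lipschitz (lo hi K k a D : R) (beta q : R -> R -> R)
    (r s : R -> R) (x : R) :
  0 <= K -> 1 <= k -> lo <= a <= hi -> tame lo hi K beta -> tame lo hi K q ->
  (forall x, continuous r x) -> (forall x, continuous s x) -> 0 <= D ->
  (forall z, lo <= z <= hi -> Rabs (r z - s z) <= D * cosh (k * (z - a))) ->
  lo <= x <= hi ->
  Rabs (nonlocal_slope beta q a r x - nonlocal_slope beta q a s x)
  <= K * exp (K * (hi - lo)) * (1 + K) * D * cosh (k * (x - a)).
Proof.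
intros HK Hk Ha Hb Hq Hr Hs HD Hrs Hx. unfold nonlocal_slope.
set (Qr := RInt (fun z => q (r z) z) a x).
set (Qs := RInt (fun z => q (s z) z) a x).
set (E := exp (K * (hi - lo))).
assert (HE : 0 < E) by apply exp_pos.
assert (HQr : Qr <= K * (hi - lo)).
{ apply Rle_trans with (1 := Rle_abs _). now apply tame_exponent_le. }
assert (HQs : Qs <= K * (hi - lo)).
{ apply Rle_trans with (1 := Rle_abs _). now apply tame_exponent_le. }
set (w := cosh (k * (x - a))).
assert (Hw : 1 <= w) by apply cosh_ge_1.
assert (HDw : 0 <= D * w) by (apply Rmult_le_pos; lra).
assert (HQ : Rabs (Qr - Qs) <= K * (D * w)).
{ assert (HI : Qr - Qs = RInt (fun z => q (r z) z - q (s z) z) a x).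
  { unfold Qr, Qs. symmetry.
    apply (RInt_minus (fun z => q (r z) z) (fun z => q (s z) z));
      apply ex_RInt_of_continuous; now apply (proj1 Hq). }
  rewrite HI.
  eapply Rle_trans; [apply (RInt_le_cosh _ k (K * D))|].
  - lra.
  - now apply Rmult_le_pos.
  - intros z.
    apply (continuous_minus (fun z => q (r z) z) (fun z => q (s z) z));
      now apply (proj1 Hq).
  - intros z Hz. assert (Hz' : lo <= z <= hi) by now apply between_range with a x.
    eapply Rle_trans; [apply (proj2 Hq); exact Hz'|].
    rewrite Rmult_assoc. apply Rmult_le_compat_l; [exact HK | now apply Hrs].
  - fold w. rewrite <- Rmult_assoc.
    apply Rmult_le_compat_r; [lra|].
    assert (0 <= K * D) by now apply Rmult_le_pos.
    assert (/ k <= 1) by (rewrite <- Rinv_1; apply Rinv_le_contravar; lra).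
    unfold Rdiv. rewrite <- (Rmult_1_r (K * D)) at 2.
    now apply Rmult_le_compat_l. }
replace (beta (r x) x * exp Qr - beta (s x) x * exp Qs)
  with ((beta (r x) x - beta (s x) x) * exp Qr
        + beta (s x) x * (exp Qr - exp Qs)) by ring.
eapply Rle_trans; [apply Rabs_triang|]. rewrite !Rabs_mult.
assert (H1 : Rabs (beta (r x) x - beta (s x) x) * Rabs (exp Qr)
             <= (K * (D * w)) * E).
{ apply Rmult_le_compat; try apply Rabs_pos.
  - eapply Rle_trans; [now apply (proj2 Hb)|].
    apply Rmult_le_compat_l; [exact HK | now apply Hrs].
  - rewrite Rabs_pos_eq by (apply Rlt_le, exp_pos). now apply exp_le_compat. }
assert (H2 : Rabs (beta (s x) x) * Rabs (exp Qr - exp Qs)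
             <= K * (E * (K * (D * w)))).
{ apply Rmult_le_compat; try apply Rabs_pos.
  - now apply (proj2 Hb (s x) (s x)).
  - eapply Rle_trans; [now apply (exp_lipschitz (K * (hi - lo)))|].
    fold E. apply Rmult_le_compat_l; lra. }
replace (K * E * (1 + K) * D * w)
  with (K * (D * w) * E + K * (E * (K * (D * w)))) by ring.
lra.
Qed.

Lemma volterra_lipschitz (lo hi K k a D : R) (beta q : R -> R -> R)
    (r s : R -> R) (x : R) :
  0 <= K -> 1 <= k -> lo <= a <= hi -> tame lo hi K beta -> tame lo hi K q ->
  (forall x, continuous r x) -> (forall x, continuous s x) -> 0 <= D ->
  (forall z, lo <= z <= hi -> Rabs (r z - s z) <= D * cosh (k * (z - a))) ->
  lo <= x <= hi ->
  Rabs (volterra beta q a r x - volterra beta q a s x)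
  <= K * exp (K * (hi - lo)) * (1 + K) * D / k * cosh (k * (x - a)).
Proof.
intros HK Hk Ha Hb Hq Hr Hs HD Hrs Hx. unfold volterra.
assert (Hcr : forall z, continuous (nonlocal_slope beta q a r) z)
  by (intros; now apply (continuous_nonlocal_slope lo hi K)).
assert (Hcs : forall z, continuous (nonlocal_slope beta q a s) z)
  by (intros; now apply (continuous_nonlocal_slope lo hi K)).
assert (HI : RInt (nonlocal_slope beta q a r) a x
             - RInt (nonlocal_slope beta q a s) a x
  = RInt (fun z => nonlocal_slope beta q a r z - nonlocal_slope beta q a s z)
      a x).
{ symmetry. now apply (RInt_minus (nonlocal_slope beta q a r)
    (nonlocal_slope beta q a s)); apply ex_RInt_of_continuous. }
rewrite HI. apply RInt_le_cosh; [lra| | |].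
- pose proof (exp_pos (K * (hi - lo))).
  repeat apply Rmult_le_pos; lra.
- intros z. now apply (continuous_minus (nonlocal_slope beta q a r)
    (nonlocal_slope beta q a s)).
- intros z Hz. apply nonlocal_slope_lipschitz; trivial.
  now apply between_range with a x.
Qed.

(** Freezing [x] outside [lo, hi] makes all the estimates on that interval
    hold on the whole line, and keeps the functions continuous. *)
Definition shooting_map (beta q : R -> R -> R) (lo hi a th : R) (r : R -> R)
    (x : R) : R :=
  th * volterra beta q a r (clip lo hi x).

(** For each [th] the equation is solved by contraction; the final value at [b]
    is Lipschitz in [th], vanishes for th = 0, and is at least 1 for th = 1 / c0,
    where c0 is the lower bound of [volterra] at [b]. *)
Lemma shooting (lo hi K m a b : R) (beta q : R -> R -> R) :
  0 <= K -> 0 < m -> lo <= a -> a < b -> b <= hi ->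
  tame lo hi K beta -> tame lo hi K q ->
  (forall s x, lo <= x <= hi -> m <= beta s x) ->
  exists (th : R) (r : R -> R),
    0 < th /\ (forall x, continuous r x) /\ r b = 1 /\
    forall x, lo <= x <= hi -> r x = th * volterra beta q a r x.
Proof.
intros HK Hm Ha Hab Hbhi Hb Hq Hmb.
assert (Haa : lo <= a <= hi) by lra.
set (l := hi - lo).
(* c0 bounds [volterra] at b below, B bounds it above, C is its Lipschitz
   constant before the gain of 1 / k; k makes th C / k <= 1 / 2. *)
set (c0 := (b - a) * (m * exp (- (K * l)))).
assert (Hc0 : 0 < c0).
{ apply Rmult_lt_0_compat; [lra|].
  apply Rmult_lt_0_compat; [exact Hm | apply exp_pos]. }
set (Th := / c0). assert (HTh : 0 < Th) by now apply Rinv_0_lt_compat.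
set (C := K * exp (K * l) * (1 + K)).
assert (HC : 0 <= C).
{ pose proof (exp_pos (K * l)). repeat apply Rmult_le_pos; lra. }
set (B := K * exp (K * l) * l).
assert (HB : 0 <= B).
{ pose proof (exp_pos (K * l)). assert (0 <= l) by (unfold l; lra).
  repeat apply Rmult_le_pos; lra. }
set (k := 1 + 2 * Th * C).
assert (HThC : 0 <= Th * C) by (apply Rmult_le_pos; lra).
assert (Hk : 1 <= k) by (unfold k; lra).
set (V := fun x => cosh (k * (clip lo hi x - a))).
assert (Hclip : forall x, lo <= clip lo hi x <= hi)
  by (intros; apply clip_range; lra).
assert (HV1 : forall x, 1 <= V x) by (intros; apply cosh_ge_1).
assert (HV : forall x, 0 <= V x <= exp (k * l)).
{ intros x. split; [pose proof (HV1 x); lra|].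
  eapply Rle_trans; [apply cosh_le_exp_Rabs|]. apply exp_le_compat.
  rewrite Rabs_mult, (Rabs_pos_eq k) by lra.
  apply Rmult_le_compat_l; [lra|]. now apply Rabs_minus_le_length. }
(* The parameter is truncated too, so that one k serves for all th. *)
set (T := fun th => shooting_map beta q lo hi a (clip 0 Th th)).
assert (Hth : forall th, 0 <= clip 0 Th th <= Th)
  by (intros; apply clip_range; lra).
assert (Hcont : forall th r, (forall x, continuous r x) ->
          forall x, continuous (T th r) x).
{ intros th r Hr x. unfold T, shooting_map.
  apply (continuous_scal_r (clip 0 Th th)
           (fun x => volterra beta q a r (clip lo hi x))).
  apply (continuous_comp (clip lo hi) (volterra beta q a r));
    [apply continuous_clip|].
  apply continuous_primitive. intros z.
  now apply (continuous_nonlocal_slope lo hi K). }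
assert (Hhalf : forall th, halving V (T th)).
{ intros th r s D Hr Hs HD Hrs x. unfold T, shooting_map.
  rewrite <- Rmult_minus_distr_l, Rabs_mult, Rabs_pos_eq by apply Hth.
  assert (Hrs' : forall z, lo <= z <= hi ->
            Rabs (r z - s z) <= D * cosh (k * (z - a))).
  { intros z Hz. pose proof (Hrs z) as H. unfold V in H.
    now rewrite clip_id in H by exact Hz. }
  pose proof (volterra_lipschitz lo hi K k a D beta q r s (clip lo hi x)
    HK Hk Haa Hb Hq Hr Hs HD Hrs' (Hclip x)) as H.
  fold l in H. fold C in H. fold (V x) in H.
  apply Rle_trans with (Th * (C * D / k * V x)).
  { apply Rmult_le_compat; [apply Hth|apply Rabs_pos|apply Hth|exact H]. }
  replace (Th * (C * D / k * V x)) with ((Th * C / k) * (D * V x))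
    by (field; lra).
  replace (D / 2 * V x) with (/ 2 * (D * V x)) by field.
  apply Rmult_le_compat_r.
  { apply Rmult_le_pos; [exact HD | apply HV]. }
  apply (Rmult_le_reg_r k); [lra|].
  unfold Rdiv. rewrite Rmult_assoc, Rinv_l by lra. unfold k. lra. }
assert (HTB : forall th r, (forall x, continuous r x) ->
          forall x, Rabs (T th r x) <= Th * B).
{ intros th r Hr x. unfold T, shooting_map.
  rewrite Rabs_mult, Rabs_pos_eq by apply Hth.
  apply Rmult_le_compat; [apply Hth|apply Rabs_pos|apply Hth|].
  now apply volterra_le. }
assert (HThB : 0 <= Th * B) by (apply Rmult_le_pos; lra).
assert (HBV : forall c x, 0 <= c -> c <= c * V x).
{ intros c x Hc. rewrite <- (Rmult_1_r c) at 1.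
  apply Rmult_le_compat_l; [exact Hc | apply HV1]. }
set (sol := fun th => picard_limit (T th)).
assert (Hsol : forall th, (forall x, continuous (sol th) x) /\
                 forall x, T th (sol th) x = sol th x).
{ intros th.
  apply (picard_limit_fixed V (exp (k * l)) (Th * B)); auto.
  intros x. eapply Rle_trans; [|apply HBV; exact HThB].
  apply HTB. intros; apply continuous_const. }
assert (Hlip : forall t t', Rabs (sol t b - sol t' b)
                 <= 2 * B * V b * Rabs (t - t')).
{ intros t t'. destruct (Hsol t) as [Hc Hf]. destruct (Hsol t') as [Hc' Hf'].
  replace (2 * B * V b * Rabs (t - t'))
    with (2 * (Rabs (t - t') * B) * V b) by ring.
  assert (HtB : 0 <= Rabs (t - t') * B)
    by (apply Rmult_le_pos; [apply Rabs_pos | exact HB]).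
  apply (almost_fixed_close V (T t) (sol t) (sol t') (2 * (Th * B))); auto.
  - apply HV.
  - lra.
  - intros x. eapply Rle_trans; [|apply HBV; lra].
    rewrite <- Hf, <- Hf'.
    unfold Rminus. eapply Rle_trans; [apply Rabs_triang|]. rewrite Rabs_Ropp.
    pose proof (HTB t (sol t) Hc x). pose proof (HTB t' (sol t') Hc' x). lra.
  - intros x. eapply Rle_trans; [|apply HBV; exact HtB].
    rewrite <- (Hf' x). unfold T, shooting_map.
    rewrite <- Rmult_minus_distr_r, Rabs_mult.
    apply Rmult_le_compat; try apply Rabs_pos; [apply clip_lipschitz|].
    now apply volterra_le. }
assert (Hclipb : clip lo hi b = b) by (apply clip_id; lra).
destruct (IVT_gen (fun t => sol t b) 0 Th 1) as (th & Hthr & Hth1).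
- intros t. apply continuity_pt_filterlim.
  now apply (continuous_of_lipschitz (fun t => sol t b) (2 * B * V b)).
- destruct (Hsol 0) as [Hc Hf]. destruct (Hsol Th) as [Hc' Hf'].
  assert (E0 : sol 0 b = 0).
  { rewrite <- Hf. unfold T, shooting_map. rewrite clip_id by lra. ring. }
  assert (E1 : 1 <= sol Th b).
  { rewrite <- Hf'. unfold T, shooting_map.
    rewrite (clip_id 0 Th) by lra. rewrite Hclipb.
    apply Rle_trans with (Th * c0); [unfold Th; rewrite Rinv_l; lra|].
    apply Rmult_le_compat_l; [lra|].
    apply (volterra_lower_bound lo hi K m); trivial; lra. }
  rewrite E0. rewrite Rmin_left, Rmax_right by lra. lra.
- rewrite Rmin_left, Rmax_right in Hthr by lra.
  destruct (Hsol th) as [Hc Hf].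
  assert (Heq : forall x, lo <= x <= hi ->
            sol th x = th * volterra beta q a (sol th) x).
  { intros x Hx. rewrite <- Hf at 1. unfold T, shooting_map.
    now rewrite (clip_id 0 Th th), (clip_id lo hi x). }
  exists th, (sol th). repeat split; trivial.
  destruct (proj1 Hthr) as [H| <-]; [exact H|].
  rewrite Heq in Hth1 by lra. lra.
Qed.

(** * Coefficients of the integral equation *)

(** Around each point choose a radius that also lies below
    1 / (1 + |g|) at that point: the uniform radius e given by compactness then
    bounds |g| by 1 / e. *)
Lemma bounded_on_rectangle (g : R -> R -> R) (a b c d : R) :
  (forall x y, continuity_2d_pt g x y) ->
  exists K, 0 <= K /\
    forall x y, a <= x <= b -> c <= y <= d -> Rabs (g x y) <= K.
Proof.
intros Hg.
assert (Hex : forall p : R * R, exists e : posreal,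
  e <= / (1 + Rabs (g (fst p) (snd p))) /\
  forall x y, Rabs (x - fst p) < e -> Rabs (y - snd p) < e ->
    Rabs (g x y - g (fst p) (snd p)) < 1).
{ intros [u v]. destruct (Hg u v (mkposreal 1 Rlt_0_1)) as [e He]. simpl in *.
  assert (Hi : 0 < / (1 + Rabs (g u v))).
  { apply Rinv_0_lt_compat. pose proof (Rabs_pos (g u v)). lra. }
  assert (Hm : 0 < Rmin e (/ (1 + Rabs (g u v)))).
  { apply Rmin_glb_lt; [apply cond_pos | exact Hi]. }
  exists (mkposreal _ Hm). simpl. split; [apply Rmin_r|].
  intros x y Hx Hy. apply He.
  - apply Rlt_le_trans with (1 := Hx), Rmin_l.
  - apply Rlt_le_trans with (1 := Hy), Rmin_l. }
destruct (functional_choice _ Hex) as [delta Hdelta].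
destruct (compactness_value_2d a b c d (fun u v => delta (u, v))) as [e He].
exists (/ e). split; [apply Rlt_le, Rinv_0_lt_compat, cond_pos|].
intros x y Hx Hy.
destruct (Rle_or_lt (Rabs (g x y)) (/ e)) as [H|H]; [exact H|].
exfalso. apply (He x y Hx Hy). intros (u & v & _ & _ & Hu & Hv & Hd).
destruct (Hdelta (u, v)) as [H1 H2]. simpl in H1, H2.
specialize (H2 x y Hu Hv).
pose proof (Rabs_triang_inv (g x y) (g u v)).
pose proof (Rabs_pos (g u v)).
assert (Hinv : / / (1 + Rabs (g u v)) <= / e).
{ apply Rinv_le_contravar; [apply cond_pos | lra]. }
rewrite Rinv_inv in Hinv. lra.
Qed.

Lemma tame_weaken (lo hi K K' : R) (f : R -> R -> R) :
  K <= K' -> tame lo hi K f -> tame lo hi K' f.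
Proof.
intros HK [Hc Hf]. split; [exact Hc|]. intros s t x Hx.
destruct (Hf s t x Hx) as [H1 H2]. split; [lra|].
apply Rle_trans with (1 := H2), Rmult_le_compat_r; [apply Rabs_pos | exact HK].
Qed.

Definition tamed (lo hi : R) (f : R -> R -> R) : Prop :=
  exists K, 0 <= K /\ tame lo hi K f.

Lemma tamed_const (lo hi c : R) : tamed lo hi (fun _ _ => c).
Proof.
exists (Rabs c). split; [apply Rabs_pos|]. split.
- intros r _ x. apply continuous_const.
- intros s t x _. rewrite Rminus_diag, Rabs_R0. split; [lra|].
  apply Rmult_le_pos; apply Rabs_pos.
Qed.

Lemma tamed_abscissa (lo hi : R) : tamed lo hi (fun _ x => x).
Proof.
exists (Rabs lo + Rabs hi).
assert (HK : 0 <= Rabs lo + Rabs hi)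
  by (pose proof (Rabs_pos lo); pose proof (Rabs_pos hi); lra).
split; [exact HK|]. split.
- intros r _ x. apply continuous_id.
- intros s t x Hx. rewrite Rminus_diag, Rabs_R0. split.
  + pose proof (Rle_abs hi). pose proof (Rle_abs (- lo)) as Hlo.
    rewrite Rabs_Ropp in Hlo.
    pose proof (Rabs_pos lo). pose proof (Rabs_pos hi). apply Rabs_le. lra.
  + apply Rmult_le_pos; [exact HK | apply Rabs_pos].
Qed.

Lemma tamed_plus (lo hi : R) (f g : R -> R -> R) :
  tamed lo hi f -> tamed lo hi g -> tamed lo hi (fun s x => f s x + g s x).
Proof.
intros (K & HK & Hfc & Hf) (L & HL & Hgc & Hg).
exists (K + L). split; [lra|]. split.
- intros r Hr x. apply (continuous_plus (fun z => f (r z) z)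
    (fun z => g (r z) z) x); auto.
- intros s t x Hx. destruct (Hf s t x Hx). destruct (Hg s t x Hx). split.
  + eapply Rle_trans; [apply Rabs_triang|]. lra.
  + replace (f s x + g s x - (f t x + g t x))
      with ((f s x - f t x) + (g s x - g t x)) by ring.
    eapply Rle_trans; [apply Rabs_triang|]. lra.
Qed.

Lemma tamed_mult (lo hi : R) (f g : R -> R -> R) :
  tamed lo hi f -> tamed lo hi g -> tamed lo hi (fun s x => f s x * g s x).
Proof.
intros (K & HK & Hfc & Hf) (L & HL & Hgc & Hg).
assert (HKL : 0 <= K * L) by now apply Rmult_le_pos.
exists (2 * (K * L)). split; [lra|]. split.
- intros r Hr x. apply (continuous_mult (fun z => f (r z) z)
    (fun z => g (r z) z) x); auto.
- intros s t x Hx. destruct (Hf s t x Hx) as [F1 F2].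
  destruct (Hg s t x Hx) as [G1 G2]. split.
  + rewrite Rabs_mult. apply Rle_trans with (K * L); [|lra].
    apply Rmult_le_compat; trivial; apply Rabs_pos.
  + replace (f s x * g s x - f t x * g t x)
      with ((f s x - f t x) * g s x + f t x * (g s x - g t x)) by ring.
    eapply Rle_trans; [apply Rabs_triang|]. rewrite !Rabs_mult.
    replace (2 * (K * L) * Rabs (s - t))
      with ((K * Rabs (s - t)) * L + K * (L * Rabs (s - t))) by ring.
    destruct (Hf t t x Hx) as [F3 _].
    apply Rplus_le_compat; apply Rmult_le_compat; trivial; apply Rabs_pos.
Qed.

Lemma tamed_inv (lo hi m : R) (f : R -> R -> R) :
  0 < m -> (forall s x, m <= f s x) -> tamed lo hi f ->
  tamed lo hi (fun s x => / f s x).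
Proof.
intros Hm Hmf (K & HK & Hfc & Hf).
assert (Hi : 0 < / m) by now apply Rinv_0_lt_compat.
assert (HKm : 0 <= K * (/ m * / m)).
{ apply Rmult_le_pos; [exact HK|]. apply Rmult_le_pos; lra. }
exists (/ m + K * (/ m * / m)). split; [lra|].
assert (Hle : forall s x, Rabs (/ f s x) <= / m).
{ intros s x. pose proof (Hmf s x).
  rewrite Rabs_pos_eq.
  - apply Rinv_le_contravar; lra.
  - apply Rlt_le, Rinv_0_lt_compat; lra. }
split.
- intros r Hr x. apply (continuous_comp (fun z => f (r z) z) Rinv x); auto.
  apply continuity_pt_filterlim.
  apply continuity_pt_inv; [apply derivable_continuous_pt, derivable_pt_id|].
  pose proof (Hmf (r x) x). unfold id. lra.
- intros s t x Hx. destruct (Hf s t x Hx) as [_ F2]. split.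
  + pose proof (Hle s x). lra.
  + replace (/ f s x - / f t x) with (- (f s x - f t x) * (/ f s x * / f t x)).
    2: { pose proof (Hmf s x). pose proof (Hmf t x). field. lra. }
    rewrite !Rabs_mult, Rabs_Ropp.
    apply Rle_trans with ((K * Rabs (s - t)) * (/ m * / m)).
    * apply Rmult_le_compat; trivial; try apply Rabs_pos.
      { apply Rmult_le_pos; apply Rabs_pos. }
      apply Rmult_le_compat; trivial; apply Rabs_pos.
    * pose proof (Rabs_pos (s - t)).
      assert (0 <= / m * Rabs (s - t)) by (apply Rmult_le_pos; lra). lra.
Qed.

(** The truncation keeps the first argument of [g] in a compact interval, on
    which the mean value theorem gives the Lipschitz bound. *)
Lemma tamed_coefficient (lo hi uL d : R) (g : R -> R -> R) (v : R -> R) :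
  smooth2 g -> (forall x, continuous v x) -> (forall x, -1 <= v x <= 1) ->
  tamed lo hi (fun s x => g (uL + d * clip (-1) 2 s) (v x)).
Proof.
intros Hg Hvc Hv.
set (lo' := uL - 2 * Rabs d). set (hi' := uL + 2 * Rabs d).
destruct (bounded_on_rectangle g lo' hi' (-1) 1) as (K & HK & Hb).
{ intros x y. apply (Hg 0%nat). }
destruct (bounded_on_rectangle (fun x y => Derive (fun z => g z y) x)
            lo' hi' (-1) 1) as (L & HL & Hb').
{ intros x y. apply (smooth2_partial_1 g Hg 0%nat). }
assert (Hr : forall s, lo' <= uL + d * clip (-1) 2 s <= hi').
{ intros s. pose proof (clip_range (-1) 2 s ltac:(lra)).
  assert (H1 : Rabs (d * clip (-1) 2 s) <= Rabs d * 2).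
  { rewrite Rabs_mult. apply Rmult_le_compat_l; [apply Rabs_pos|].
    apply Rabs_le; lra. }
  apply Rabs_le_between in H1. unfold lo', hi'. lra. }
pose proof (Rabs_pos d) as Hd.
assert (HLd : 0 <= L * Rabs d) by now apply Rmult_le_pos.
exists (K + L * Rabs d). split; [lra|]. split.
- intros r Hrc x.
  apply (smooth2_continuous g (fun z => uL + d * clip (-1) 2 (r z)) v x Hg);
    [|apply Hvc].
  apply (continuous_plus (fun _ => uL) (fun z => d * clip (-1) 2 (r z)));
    [apply continuous_const|].
  apply (continuous_scal_r d (fun z => clip (-1) 2 (r z))).
  apply (continuous_comp r (clip (-1) 2) x); [apply Hrc | apply continuous_clip].
- intros s t x _. split.
  + pose proof (Hb _ (v x) (Hr s) (Hv x)). lra.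
  + set (us := uL + d * clip (-1) 2 s) in *.
    set (ut := uL + d * clip (-1) 2 t) in *.
    destruct (MVT_gen (fun z => g z (v x)) ut us
                (fun y => Derive (fun z => g z (v x)) y)) as (c & Hc & E).
    * intros y _. apply Derive_correct.
      exact (proj1 (proj2 (Hg 1%nat y (v x)))).
    * intros y _. apply continuity_pt_filterlim.
      apply (smooth2_continuous g (fun z => z) (fun _ => v x) y Hg);
        [apply continuous_id | apply continuous_const].
    * rewrite E, Rabs_mult.
      assert (Hcr : lo' <= c <= hi').
      { now apply between_range with (3 := Hc); apply Hr. }
      assert (Hust : Rabs (us - ut) <= Rabs d * Rabs (s - t)).
      { replace (us - ut) with (d * (clip (-1) 2 s - clip (-1) 2 t))
          by (unfold us, ut; ring).
        rewrite Rabs_mult. apply Rmult_le_compat_l; [exact Hd|].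
        apply clip_lipschitz. }
      apply Rle_trans with (L * (Rabs d * Rabs (s - t))).
      { apply Rmult_le_compat; trivial; try apply Rabs_pos.
        apply (Hb' c (v x)); trivial. }
      pose proof (Rabs_pos (s - t)).
      assert (0 <= K * Rabs (s - t)) by now apply Rmult_le_pos. lra.
Qed.

(** * The viscous profile *)

(** The logarithmic derivative of w = B0 u_x along a solution. *)
Definition log_rate (eps : R) (a0 a1 b0 : R -> R -> R) (x u v : R) : R :=
  (- x * a0 u v + a1 u v) / (eps * b0 u v).

(** The truncated problem is solved on [-M-1, M+1]; [delta] is the length by
    which r can be followed past -M and M without leaving [-1, 2]. *)
Lemma viscous_profile (eps M uL d c2 c3 : R) (a0 a1 b0 : R -> R -> R)
    (v : R -> R) :
  0 < eps -> 0 < M -> 0 < c2 ->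
  smooth2 a0 -> smooth2 a1 -> smooth2 b0 ->
  (forall u w, -1 <= w <= 1 -> c2 <= b0 u w <= c3) ->
  (forall x, continuous v x) -> (forall x, -1 <= v x <= 1) ->
  exists (delta th : R) (r Q : R -> R),
    0 < delta /\ 0 < th /\ r (- M) = 0 /\ r M = 1 /\
    forall x, - M - delta < x < M + delta ->
      is_derive r x (th * (exp (Q x) / b0 (uL + d * r x) (v x))) /\
      is_derive Q x (log_rate eps a0 a1 b0 x (uL + d * r x) (v x)).
Proof.
intros Heps HM Hc2 Ha0 Ha1 Hb0 Hb Hvc Hv.
(* Any interval with -M and M in its interior would do. *)
set (lo := - M - 1). set (hi := M + 1).
set (U := fun s => uL + d * clip (-1) 2 s).
set (beta := fun s x => / b0 (U s) (v x)).
set (q := fun s x =>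
  (-1 * x * a0 (U s) (v x) + a1 (U s) (v x)) * (/ eps * beta s x)).
assert (Hbeta : tamed lo hi beta).
{ apply (tamed_inv lo hi c2); [exact Hc2| |now apply tamed_coefficient].
  intros s x. now apply Hb. }
assert (Hq : tamed lo hi q).
{ apply tamed_mult.
  - apply tamed_plus; [|now apply tamed_coefficient].
    apply tamed_mult; [|now apply tamed_coefficient].
    apply tamed_mult; [apply tamed_const | apply tamed_abscissa].
  - apply tamed_mult; [apply tamed_const | exact Hbeta]. }
destruct Hbeta as (K1 & HK1 & Hbeta). destruct Hq as (K2 & HK2 & Hq).
set (K := Rmax K1 K2).
apply (tame_weaken _ _ _ K) in Hbeta; [|apply Rmax_l].
apply (tame_weaken _ _ _ K) in Hq; [|apply Rmax_r].
assert (HK : 0 <= K) by (apply Rle_trans with (1 := HK1), Rmax_l).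
assert (Hc3 : 0 < c3) by (pose proof (Hb 0 0 ltac:(lra)); lra).
assert (Hm : forall s x, / c3 <= beta s x).
{ intros s x. pose proof (Hb (U s) (v x) (Hv x)).
  apply Rinv_le_contravar; lra. }
destruct (shooting lo hi K (/ c3) (- M) M beta q) as (th & r & Hth & Hrc & HrM & Hr);
  trivial; try (unfold lo, hi; lra).
{ now apply Rinv_0_lt_compat. }
set (Q := fun x : R => (RInt (fun z => q (r z) z) (- M) x : R)).
assert (Hsc : forall z, continuous (nonlocal_slope beta q (- M) r) z)
  by (intros; now apply (continuous_nonlocal_slope lo hi K)).
assert (Hr0 : r (- M) = 0).
{ rewrite Hr by (unfold lo, hi; lra). unfold volterra.
  rewrite RInt_point. unfold zero; simpl. ring. }
assert (Hmono : forall x y, lo <= x -> x <= y -> y <= hi -> r x <= r y).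
{ intros x y Hx Hxy Hy. rewrite !Hr by lra.
  apply Rmult_le_compat_l; [lra|]. unfold volterra.
  pose proof (RInt_minus_start _ (- M) x y Hsc) as H.
  assert (0 <= RInt (nonlocal_slope beta q (- M) r) x y); [|lra].
  apply RInt_nonneg_of_continuous; trivial. intros z _.
  apply Rmult_le_pos; [|apply Rlt_le, exp_pos].
  pose proof (Hm (r z) z). pose proof (Rinv_0_lt_compat c3 Hc3). lra. }
(* 1 is the margin between the values 0 and 1 of r at -M and M and the ends
   of [-1, 2]. *)
destruct (proj1 (filterlim_locally _ _) (Hrc M) (mkposreal 1 Rlt_0_1))
  as [d1 Hd1].
destruct (proj1 (filterlim_locally _ _) (Hrc (- M)) (mkposreal 1 Rlt_0_1))
  as [d2 Hd2].
set (delta := Rmin 1 (Rmin d1 d2)).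
assert (Hdelta : 0 < delta).
{ apply Rmin_glb_lt; [lra|]. apply Rmin_glb_lt; apply cond_pos. }
assert (Hdle : delta <= 1 /\ delta <= d1 /\ delta <= d2).
{ split; [apply Rmin_l|]. split.
  - apply Rle_trans with (1 := Rmin_r _ _), Rmin_l.
  - apply Rle_trans with (1 := Rmin_r _ _), Rmin_r. }
assert (Hrange : forall x, - M - delta < x < M + delta -> -1 <= r x <= 2).
{ intros x Hx. split.
  - destruct (Rle_or_lt (- M) x) as [H|H].
    + pose proof (Hmono (- M) x). unfold lo, hi in *. lra.
    + assert (Hx2 : Rabs (x - - M) < d2) by (apply Rabs_def1; lra).
      specialize (Hd2 x Hx2).
      change (Rabs (r x - r (- M)) < 1) in Hd2.
      apply Rabs_def2 in Hd2. lra.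
  - destruct (Rle_or_lt x M) as [H|H].
    + pose proof (Hmono x M). unfold lo, hi in *. lra.
    + assert (Hx2 : Rabs (x - M) < d1) by (apply Rabs_def1; lra).
      specialize (Hd1 x Hx2).
      change (Rabs (r x - r M) < 1) in Hd1.
      apply Rabs_def2 in Hd1. lra. }
exists delta, th, r, Q.
split; [exact Hdelta|split; [exact Hth|split; [exact Hr0|split; [exact HrM|]]]].
intros x H. split.
- replace (th * (exp (Q x) / b0 (uL + d * r x) (v x)))
    with (th * nonlocal_slope beta q (- M) r x).
  2: { unfold nonlocal_slope, beta, U. fold (Q x).
       rewrite clip_id by now apply Hrange. unfold Rdiv. ring. }
  apply (is_derive_ext_loc (K := R_AbsRing) (V := R_NormedModule)
           (fun y => th * volterra beta q (- M) r y) r x).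
  + assert (HD : open (fun y => lo < y /\ y < hi))
      by (apply open_and; [apply open_gt | apply open_lt]).
    assert (Hx : lo < x /\ x < hi) by (unfold lo, hi; lra).
    generalize (HD x Hx). apply filter_imp. intros y Hy.
    symmetry. apply Hr. lra.
  + apply (is_derive_scal (volterra beta q (- M) r) x th).
    now apply is_derive_primitive.
- replace (log_rate eps a0 a1 b0 x (uL + d * r x) (v x)) with (q (r x) x).
  2: { unfold q, beta, U, log_rate. rewrite clip_id by now apply Hrange.
       pose proof (Hb (uL + d * r x) (v x) (Hv x)). field. lra. }
  exact (is_derive_primitive (fun z => q (r z) z) (- M) x
           (proj1 Hq r Hrc)).
Qed.

Lemma class_C_subset (D E : R -> Prop) (n : nat) :
  forall f, (forall x, E x -> D x) -> class_C n D f -> class_C n E f.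
Proof.
induction n as [|n IH]; intros f HED Hf.
- intros x Hx. now apply Hf, HED.
- destruct Hf as [Hd Hf]. split.
  + intros x Hx. now apply Hd, HED.
  + now apply IH.
Qed.

(** If r and exp (Q) are of class C^n, the system shows that their derivatives
    are too. *)
Lemma profile_class_C (D : R -> Prop) (eps uL d th : R)
    (a0 a1 b0 : R -> R -> R) (v r Q : R -> R) :
  open D -> 0 < eps ->
  smooth2 a0 -> smooth2 a1 -> smooth2 b0 ->
  (forall u x, 0 < b0 u (v x)) ->
  (forall n, class_C n D v) ->
  (forall x, D x ->
     is_derive r x (th * (exp (Q x) / b0 (uL + d * r x) (v x))) /\
     is_derive Q x (log_rate eps a0 a1 b0 x (uL + d * r x) (v x))) ->
  forall n, class_C n D (fun x => uL + d * r x).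
Proof.
intros HD Heps Ha0 Ha1 Hb0 Hpos Hv Hode.
assert (HE : forall x, D x -> is_derive (fun y => exp (Q y)) x
  (exp (Q x) * log_rate eps a0 a1 b0 x (uL + d * r x) (v x))).
{ intros x Hx. rewrite Rmult_comm.
  apply (is_derive_comp exp Q x); [apply is_derive_exp | now apply Hode]. }
assert (Hu : forall n, class_C n D r -> class_C n D (fun x => uL + d * r x)).
{ intros n Hn. apply class_C_plus; trivial; [now apply class_C_const|].
  apply class_C_mult; trivial. now apply class_C_const. }
assert (H : forall n, class_C n D r /\ class_C n D (fun x => exp (Q x))).
{ induction n as [|n [IHr IHE]].
  - split; intros x Hx.
    + apply continuous_of_is_derive with (1 := proj1 (Hode x Hx)).
    + apply continuous_of_is_derive with (1 := HE x Hx).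
  - assert (Hcoef : forall g, smooth2 g ->
              class_C n D (fun x => g (uL + d * r x) (v x))).
    { intros g Hg. apply class_C_comp2; auto. }
    split.
    + apply (class_C_is_derive D HD n r _ (fun x Hx => proj1 (Hode x Hx))).
      apply class_C_mult; trivial; [now apply class_C_const|].
      apply class_C_mult; trivial. apply class_C_inv; trivial; [|now apply Hcoef].
      intros x _. apply Rgt_not_eq, Hpos.
    + apply (class_C_is_derive D HD n _ _ HE).
      apply class_C_mult; trivial. apply class_C_mult; trivial.
      * apply class_C_plus; trivial; [|now apply Hcoef].
        apply class_C_mult; trivial; [|now apply Hcoef].
        apply (class_C_ext D HD n (fun x => -1 * x)); [intros; ring|].
        apply class_C_mult; trivial; [now apply class_C_const|].
        now apply class_C_id.
      * apply class_C_inv; trivial.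
        { intros x _. apply Rgt_not_eq.
          apply Rmult_gt_0_compat; [exact Heps | apply Hpos]. }
        apply class_C_mult; trivial; [now apply class_C_const|].
        now apply Hcoef. }
intros n. apply Hu, H.
Qed.

Lemma derive_nonneg_le (f df : R -> R) (a b : R) :
  a <= b -> (forall x, a <= x <= b -> is_derive f x (df x)) ->
  (forall x, a <= x <= b -> 0 <= df x) -> f a <= f b.
Proof.
intros Hab Hd Hpos.
destruct (MVT_gen f a b df) as (c & Hc & E);
  rewrite ?Rmin_left, ?Rmax_right in * by exact Hab.
- intros x Hx. apply Hd. lra.
- intros x Hx. apply continuity_pt_filterlim.
  now apply continuous_of_is_derive with (df x), Hd.
- pose proof (Rmult_le_pos (df c) (b - a) (Hpos c Hc) ltac:(lra)). lra.
Qed.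

(** * The implicit formula *)

(** The integrand of [h] is - eps times [log_rate], as A0 cancels in the product
    of [lambda] and [G]. *)
Lemma h_of_log_rate (A0 A1 B0 : R -> R -> R) (eps a b : R) (u v Q : R -> R)
    (alpha x : R) :
  0 < eps ->
  (forall z, A0 (u z) (v z) <> 0) -> (forall z, B0 (u z) (v z) <> 0) ->
  (forall z, a <= z <= b ->
     is_derive Q z (log_rate eps A0 A1 B0 z (u z) (v z)) /\
     continuous (fun y => log_rate eps A0 A1 B0 y (u y) (v y)) z) ->
  a <= alpha <= b -> a <= x <= b ->
  h A0 A1 B0 u v alpha x = - eps * (Q x - Q alpha).
Proof.
intros Heps HA HB HQ Halpha Hx. unfold h.
apply is_RInt_unique.
apply (is_RInt_ext
  (fun z => scal (- eps) (log_rate eps A0 A1 B0 z (u z) (v z)))).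
{ intros z _. unfold lambda, G, log_rate, scal; simpl; unfold mult; simpl.
  pose proof (HA z). pose proof (HB z). field. repeat split; trivial; lra. }
apply (is_RInt_scal (fun z => log_rate eps A0 A1 B0 z (u z) (v z))).
apply (is_RInt_derive Q); intros z Hz; apply HQ;
  now apply between_range with alpha x.
Qed.

(** The base point alpha only enters through the factor exp (- Q alpha), so it
    disappears from the quotient in the implicit formula. *)
Lemma RInt_u_density (A0 A1 B0 : R -> R -> R) (eps th a b : R)
    (u v r Q : R -> R) (alpha x : R) :
  0 < eps -> 0 < th ->
  (forall z, A0 (u z) (v z) <> 0) -> (forall z, B0 (u z) (v z) <> 0) ->
  (forall z, a <= z <= b ->
     continuous (fun y => B0 (u y) (v y)) z /\
     is_derive r z (th * (exp (Q z) / B0 (u z) (v z))) /\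
     is_derive Q z (log_rate eps A0 A1 B0 z (u z) (v z)) /\
     continuous (fun y => log_rate eps A0 A1 B0 y (u y) (v y)) z) ->
  a <= alpha <= b -> a <= x <= b ->
  RInt (u_density A0 A1 B0 u v alpha eps) a x
  = exp (- Q alpha) / th * (r x - r a).
Proof.
intros Heps Hth HA HB Hode Halpha Hx.
apply is_RInt_unique.
apply (is_RInt_ext (fun z => scal (exp (- Q alpha) / th)
                     (th * (exp (Q z) / B0 (u z) (v z))))).
{ intros z Hz. rewrite Rmin_left, Rmax_right in Hz by lra.
  unfold u_density.
  rewrite (h_of_log_rate A0 A1 B0 eps a b u v Q alpha z); trivial; try lra.
  2: { intros y Hy. split; now apply Hode. }
  replace (- (- eps * (Q z - Q alpha)) / eps) with (- Q alpha + Q z)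
    by (field; lra).
  rewrite exp_plus. unfold scal; simpl; unfold mult; simpl.
  pose proof (HB z). field. split; [trivial | lra]. }
apply (is_RInt_scal (fun z => th * (exp (Q z) / B0 (u z) (v z)))).
apply (is_RInt_derive r); intros z Hz;
  rewrite Rmin_left, Rmax_right in Hz by lra; destruct (Hode z) as (Hc & Hr & HQ & _);
  try lra; [exact Hr|].
apply (continuous_scal_r th (fun y => exp (Q y) / B0 (u y) (v y))).
apply (continuous_mult (fun y => exp (Q y)) (fun y => / B0 (u y) (v y)) z).
- apply continuous_exp_comp. now apply continuous_of_is_derive with (1 := HQ).
- apply (continuous_comp (fun y => B0 (u y) (v y)) Rinv z Hc).
  apply continuity_pt_filterlim, continuity_pt_inv; [|apply HB].
  apply derivable_continuous_pt, derivable_pt_id.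
Qed.

(** * Existence of the viscous solution *)

Theorem proposition3p1
  (uL uR p : R) (hp : 0 < p)
  (A0 A1 B0 : R -> R -> R)
  (hA0 : smooth_on_strip A0)
  (hA1 : smooth_on_strip A1)
  (hB0 : smooth_on_strip B0)
  (c1 c2 c3 : R) (hc1 : 0 < c1) (hc2 : 0 < c2)
  (hA0_bound : forall u v : R, -1 <= v <= 1 -> c1 <= A0 u v)
  (hB0_bound : forall u v : R, -1 <= v <= 1 -> c2 <= B0 u v <= c3)
  (fm fp gm gp : R -> R)
  (hfm : smooth fm) (hfp : smooth fp)
  (hgm : smooth gm) (hgp : smooth gp)
  (hgm_inv : Bijective gm) (hgp_inv : Bijective gp)
  (hA0_m : forall u : R, A0 u (-1) = Derive gm u)
  (hA0_p : forall u : R, A0 u 1 = Derive gp u)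
  (hA1_m : forall u : R, A1 u (-1) = Derive (fun w => fm (gm w)) u)
  (hA1_p : forall u : R, A1 u 1 = Derive (fun w => fp (gp w)) u)
  (Lambda M : R) (hLambda : 0 < Lambda)
  (hlambda : forall u v : R, Omega uL uR u -> -1 <= v <= 1 ->
     Rabs (lambda A0 A1 u v) <= Lambda)
  (hM : Lambda < M)
  (eps : R) (heps : 0 < eps) :
  exists u v : R -> R,
    (* the two differential equations *)
    (forall xi : R, -M <= xi <= M ->
       (- xi * A0 (u xi) (v xi) + A1 (u xi) (v xi)) * Derive u xi
       = eps * Derive (fun z => B0 (u z) (v z) * Derive u z) xi) /\
    (forall xi : R, - xi * Derive v xi = Rpower eps p * Derive_n v 2 xi) /\
    (* boundary conditions *)
    u (-M) = uL /\ u M = uR /\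
    is_lim v m_infty (-1) /\ is_lim v p_infty 1 /\
    (* regularity and range *)
    smooth_on_segment (-M) M u /\ smooth v /\
    (forall xi : R, -M <= xi <= M -> continuous u xi) /\
    (forall xi : R, continuous v xi) /\
    (forall xi : R, -M <= xi <= M -> Omega uL uR (u xi)) /\
    (forall xi : R, -1 <= v xi <= 1) /\
    (* implicit formula for u, whatever the base point of h *)
    (forall alpha xi : R, -M <= alpha <= M -> -M <= xi <= M ->
       u xi = uL + (uR - uL) *
         (RInt (u_density A0 A1 B0 u v alpha eps) (-M) xi /
          RInt (u_density A0 A1 B0 u v alpha eps) (-M) M)) /\
    (forall xi : R,
       v xi = -1 + 2 *
         (RInt_gen (v_density p eps) (Rbar_locally m_infty) (at_point xi) /
          RInt_gen (v_density p eps) (Rbar_locally m_infty)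
                                     (Rbar_locally p_infty))) /\
    (* monotonicity and total variation *)
    monotone_on (fun x => -M <= x <= M) u /\
    monotone_on (fun _ => True) v /\
    Rbar_le (total_variation (fun x => -M <= x <= M) u) (Rabs (uR - uL)) /\
    Rbar_le (total_variation (fun _ => True) v) 2.
Proof.
destruct (viscous_layer (Rpower eps p)) as
  (v & Hv_ode & Hv_m & Hv_p & Hv_C & Hv_range & Hv_mono & Hv_formula).
{ apply exp_pos. }
assert (Hvc : forall x, continuous v x) by (intros x; now apply (Hv_C 0%nat)).
destruct hA0 as (a0 & Ha0 & EA0). destruct hA1 as (a1 & Ha1 & EA1).
destruct hB0 as (b0 & Hb0 & EB0).
set (d := uR - uL).
assert (Hb0_bound : forall u w, -1 <= w <= 1 -> c2 <= b0 u w <= c3).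
{ intros u w Hw. rewrite EB0 by exact Hw. now apply hB0_bound. }
destruct (viscous_profile eps M uL d c2 c3 a0 a1 b0 v)
  as (delta & th & r & Q & Hdelta & Hth & Hr0 & Hr1 & Hode); trivial; [lra|].
set (D := fun x => - M - delta < x < M + delta).
assert (HD : open D) by (apply open_and; [apply open_gt | apply open_lt]).
assert (HMD : forall x, - M <= x <= M -> D x) by (intros x Hx; unfold D; lra).
set (u := fun x => uL + d * r x).
assert (Hu_C : forall n, class_C n D u).
{ apply (profile_class_C D eps uL d th a0 a1 b0 v r Q); trivial.
  - intros w x. pose proof (Hb0_bound w (v x) (Hv_range x)). lra.
  - intros n. now apply class_C_subset with (fun _ => True). }
assert (Huc : forall x, D x -> continuous u x) by apply (Hu_C 0%nat).
assert (HB : forall z, B0 (u z) (v z) <> 0).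
{ intros z. pose proof (hB0_bound (u z) (v z) (Hv_range z)). lra. }
assert (HA : forall z, A0 (u z) (v z) <> 0).
{ intros z. pose proof (hA0_bound (u z) (v z) (Hv_range z)). lra. }
assert (Hr : forall x, D x ->
          is_derive r x (th * (exp (Q x) / B0 (u x) (v x)))).
{ intros x Hx. rewrite <- EB0 by apply Hv_range. now apply Hode. }
assert (HQ : forall x, D x ->
          is_derive Q x (log_rate eps A0 A1 B0 x (u x) (v x))).
{ intros x Hx. unfold log_rate.
  rewrite <- EA0, <- EA1, <- EB0 by apply Hv_range. now apply Hode. }
assert (Hgc : forall g g' x, smooth2 g' ->
          (forall s w, -1 <= w <= 1 -> g' s w = g s w) -> D x ->
          continuous (fun y => g (u y) (v y)) x).
{ intros g g' x Hg' E Hx.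
  apply continuous_ext with (fun y => g' (u y) (v y)).
  - intros y. now apply E.
  - apply smooth2_continuous; auto. }
assert (Hrate : forall x, D x ->
          continuous (fun y => log_rate eps A0 A1 B0 y (u y) (v y)) x).
{ intros x Hx. unfold log_rate.
  apply (continuous_mult
    (fun y => - y * A0 (u y) (v y) + A1 (u y) (v y))
    (fun y => / (eps * B0 (u y) (v y))) x).
  - apply (continuous_plus (fun y => - y * A0 (u y) (v y))
      (fun y => A1 (u y) (v y)) x); [|now apply Hgc with a1].
    apply (continuous_mult Ropp (fun y => A0 (u y) (v y)) x);
      [|now apply Hgc with a0].
    apply (continuous_opp (fun y : R => y) x), continuous_id.
  - apply (continuous_comp (fun y => eps * B0 (u y) (v y)) Rinv x).
    + apply (continuous_scal_r eps (fun y => B0 (u y) (v y))).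
      now apply Hgc with b0.
    + apply continuity_pt_filterlim, continuity_pt_inv.
      * apply derivable_continuous_pt, derivable_pt_id.
      * unfold id. apply Rmult_integral_contrapositive. split; [lra | apply HB]. }
assert (Hu : forall x, D x ->
          is_derive u x (d * (th * (exp (Q x) / B0 (u x) (v x))))).
{ intros x Hx. unfold u at 1.
  rewrite <- (Rplus_0_l (d * _)).
  apply (is_derive_plus (fun _ => uL) (fun y => d * r y) x).
  - apply (is_derive_const uL x).
  - apply (is_derive_scal r x d). now apply Hr. }
assert (Hr_mono : forall x y, - M <= x -> x <= y -> y <= M -> r x <= r y).
{ intros x y Hx Hxy Hy.
  apply (derive_nonneg_le r
           (fun z => th * (exp (Q z) / B0 (u z) (v z)))); trivial.
  - intros z Hz. apply Hr, HMD. lra.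
  - intros z _. pose proof (hB0_bound (u z) (v z) (Hv_range z)).
    apply Rmult_le_pos; [lra|].
    apply Rlt_le, Rdiv_lt_0_compat; [apply exp_pos | lra]. }
assert (Hr_range : forall x, - M <= x <= M -> 0 <= r x <= 1).
{ intros x Hx. rewrite <- Hr0, <- Hr1. split; apply Hr_mono; lra. }
assert (Hmono_u : monotone_on (fun x => - M <= x <= M) u).
{ unfold u. destruct (Rle_or_lt 0 d) as [Hd|Hd]; [left|right];
    intros x y Hx Hy Hxy; pose proof (Hr_mono x y ltac:(lra) Hxy ltac:(lra));
    apply Rplus_le_compat_l.
  - now apply Rmult_le_compat_l.
  - apply Rmult_le_compat_neg_l; lra. }
assert (Hmono_v : monotone_on (fun _ => True) v).
{ left. intros x y _ _. apply Hv_mono. }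
exists u, v.
split; [|split; [exact Hv_ode|split; [|split; [|split; [exact Hv_m|
split; [exact Hv_p|split; [|split; [|split; [|split; [exact Hvc|
split; [|split; [exact Hv_range|split; [|split; [exact Hv_formula|
split; [exact Hmono_u|split; [exact Hmono_v|split]]]]]]]]]]]]]]]].
- intros x Hx. pose proof (HMD x Hx) as HDx.
  rewrite (is_derive_unique u x _ (Hu x HDx)).
  (* The flux B0 u_x is a constant multiple of exp (Q). *)
  assert (Hw : forall z, D z ->
            d * th * exp (Q z) = B0 (u z) (v z) * Derive u z).
  { intros z Hz. rewrite (is_derive_unique u z _ (Hu z Hz)). pose proof (HB z).
    field. trivial. }
  assert (Hflux : Derive (fun z => B0 (u z) (v z) * Derive u z) x
    = d * th * (exp (Q x) * log_rate eps A0 A1 B0 x (u x) (v x))).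
  { apply is_derive_unique.
    apply (is_derive_ext_loc (K := R_AbsRing) (V := R_NormedModule)
             (fun z => d * th * exp (Q z)) _ x).
    - exact (filter_imp _ _ Hw (HD x HDx)).
    - apply (is_derive_scal (fun z => exp (Q z)) x (d * th)).
      rewrite Rmult_comm.
      apply (is_derive_comp exp Q x); [apply is_derive_exp | now apply HQ]. }
  rewrite Hflux. unfold log_rate. pose proof (HB x). field.
  split; [trivial | lra].
- unfold u. rewrite Hr0. ring.
- unfold u, d. rewrite Hr1. ring.
- intros n x Hx. apply (class_C_ex_derive_n D u Hu_C). now apply HMD.
- intros n x. now apply (class_C_ex_derive_n (fun _ => True) v Hv_C).
- intros x Hx. now apply Huc, HMD.
- intros x Hx. pose proof (Hr_range x Hx) as H. unfold Omega, u, d.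
  unfold Rmin, Rmax. destruct (Rle_dec uL uR); split; nra.
- intros alpha x Halpha Hx.
  assert (Hint : forall y, - M <= y <= M ->
    RInt (u_density A0 A1 B0 u v alpha eps) (- M) y
    = exp (- Q alpha) / th * (r y - r (- M))).
  { intros y Hy.
    apply (RInt_u_density A0 A1 B0 eps th (- M) M u v r Q); trivial.
    intros z Hz. pose proof (HMD z Hz) as HDz.
    split; [now apply Hgc with b0|]. split; [now apply Hr|].
    split; [now apply HQ | now apply Hrate]. }
  rewrite !Hint by lra. rewrite Hr0, Hr1. fold d. unfold u.
  pose proof (exp_pos (- Q alpha)). field. lra.
- apply total_variation_monotone; [exact Hmono_u|].
  intros x y Hx Hy. unfold u. fold d.
  replace (uL + d * r x - (uL + d * r y)) with (d * (r x - r y)) by ring.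
  rewrite Rabs_mult. apply Rle_trans with (Rabs d * 1); [|fold d; lra].
  apply Rmult_le_compat_l; [apply Rabs_pos|].
  pose proof (Hr_range x Hx). pose proof (Hr_range y Hy).
  apply Rabs_le. lra.
- apply total_variation_monotone; [exact Hmono_v|].
  intros x y _ _. pose proof (Hv_range x). pose proof (Hv_range y).
  apply Rabs_le. lra.
Qed.
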